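(* Let $\rho\in(0,1]$ and let $\widetilde V\in L^\infty(\mathbb R^n)$ satisfy $\widetilde V(x)=\widetilde V_1(x)+\widetilde V_2(x)$, where $\widetilde V_1$ is complex valued with $$|\widetilde V_1(x)|\le\frac{c_1}{\langle x\rangle^{1/2}}=\frac{c_1}{(1+|x|^2)^{1/4}},$$ and $\widetilde V_2$ is real valued and supported in $\{x\in\mathbb R^n:|x|\ge1\}$ with $$-(\partial_r\widetilde V_2(x))^-\le\frac{c_2}{|x|}.$$ Then there exists $\tau_0=\tau_0(\rho;\|\widetilde V\|_\infty;c_1;c_2)>0$ such that the inequality $$\tau^{3/2}\,\big\|\,|x|^{-1/2}e^{\tau|x|}g\big\|_2\le\big\|e^{\tau|x|}(\Delta g+\widetilde Vg)\big\|_2$$ holds for any $\tau\ge\tau_0$ and any $g\in C_0^\infty(\mathbb R^n\setminus\overline{B_\rho(0)})$.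
   Context: The dimension $n$ is fixed. Notation: $\|\cdot\|_2$ is the $L^2(\mathbb R^n)$ norm; $B_\rho(0)$ is the open ball of radius $\rho$ centered at $0$; $\langle x\rangle=(1+|x|^2)^{1/2}$; $a^-=\min\{a,0\}$ for real $a$; $\partial_r=\frac{x}{|x|}\cdot\nabla$ is the radial derivative. $\tau_0(\cdots)$ means that $\tau_0$ depends only on the listed quantities (for the fixed dimension $n$). *)

(* Defs.v *)
From HB Require Import structures.
From mathcomp Require Import all_boot all_order all_algebra.
From mathcomp Require Import all_classical all_reals all_analysis.
From mathcomp Require Import complex.

Set Implicit Arguments.
Unset Strict Implicit.
Unset Printing Implicit Defensive.
Import Order.TTheory GRing.Theory Num.Theory.
Import numFieldNormedType.Exports.
Local Open Scope classical_set_scope.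
Local Open Scope ring_scope.

(* R^n is ['rV[R]_n], whose library topology is the usual one.  Its Borel
   sigma-algebra is generated by the coordinates, exactly as the library does
   for [n.-tuple]. *)
Definition rV_display : measure_display -> measure_display.
Proof. exact. Qed.

Section measurable_rV.
Context (R : realType) (n : nat).

Let coors : 'I_n -> 'rV[R]_n -> measurableTypeR R := fun i x => x ord0 i.

Let rV_set0 : g_sigma_preimage coors set0.
Proof. exact: sigma_algebra0. Qed.

Let rV_setC A : g_sigma_preimage coors A -> g_sigma_preimage coors (~` A).
Proof. exact: sigma_algebraC. Qed.

Let rV_bigcup (F : (set 'rV[R]_n)^nat) :
  (forall i, g_sigma_preimage coors (F i)) ->
  g_sigma_preimage coors (\bigcup_i (F i)).
Proof. exact: sigma_algebra_bigcup. Qed.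

HB.instance Definition _ :=
  @isMeasurable.Build (rV_display default_measure_display)
  'rV[R]_n (g_sigma_preimage coors) rV_set0 rV_setC rV_bigcup.

End measurable_rV.

Lemma measurable_coord (R : realType) n (i : 'I_n) :
  measurable_fun setT (fun x : 'rV[R]_n => x ord0 i : measurableTypeR R).
Proof.
move=> _ Y mY; rewrite setTI; apply: sub_sigma_algebra => /=.
rewrite -bigcup_seq/=; exists i => /=; first by rewrite mem_index_enum.
by exists Y => //; rewrite setTI.
Qed.

Lemma measurable_fun_rVP (R : realType) n d (T : measurableType d)
    (f : T -> 'rV[R]_n) :
  (forall i, measurable_fun setT (fun t => f t ord0 i : measurableTypeR R)) ->
  measurable_fun setT f.
Proof.
move=> mf _ A mA; rewrite setTI.
have : preimage_set_system setT f (g_sigma_preimage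
    (fun i (x : 'rV[R]_n) => x ord0 i : measurableTypeR R)) `<=` measurable.
  rewrite -g_sigma_preimage_comp.
  apply: smallest_sub; first exact: sigma_algebra_measurable.
  rewrite -bigcup_seq; apply: bigcup_sub => i _ _ [B mB <-].
  exact: mf.
by apply; exists A => //; rewrite setTI.
Qed.

Section rV_cons.
Context (R : realType) (n : nat).

Definition rV_cons (p : measurableTypeR R * 'rV[R]_n) : 'rV[R]_n.+1 :=
  \row_i oapp (p.2 ord0) p.1 (unlift ord0 i).

Definition rV_uncons (v : 'rV[R]_n.+1) : measurableTypeR R * 'rV[R]_n :=
  (v ord0 ord0, \row_i v ord0 (lift ord0 i)).

Lemma rV_consK : cancel rV_cons rV_uncons.
Proof.
case=> x v; rewrite /rV_cons /rV_uncons !mxE unlift_none /=; congr pair.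
by apply/rowP => i; rewrite !mxE liftK.
Qed.

Lemma rV_unconsK : cancel rV_uncons rV_cons.
Proof.
move=> v; apply/rowP => i; rewrite !mxE.
by case: unliftP => [j|] -> //=; rewrite mxE.
Qed.

Lemma measurable_rV_cons : measurable_fun setT rV_cons.
Proof.
apply: measurable_fun_rVP => i.
under eq_fun do rewrite mxE.
case: (unlift ord0 i) => [j|] /=; last exact: measurable_fst.
exact: (measurableT_comp (measurable_coord j) measurable_snd).
Qed.

Lemma measurable_rV_uncons : measurable_fun setT rV_uncons.
Proof.
apply/measurable_fun_pairP; split => /=; first exact: measurable_coord.
apply: measurable_fun_rVP => i /=; under eq_fun do rewrite mxE.
exact: measurable_coord.
Qed.

End rV_cons.

Section lebesgue_step.
Context (R : realType) (n : nat).
Variable m : {sigma_finite_measure set 'rV[R]_n -> \bar R}.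

Definition lebesgue_step : set 'rV[R]_n.+1 -> \bar R :=
  pushforward (@lebesgue_measure R \x m)%E (@rV_cons R n).

Let mcons := @measurable_rV_cons R n.

Let lebesgue_step0 : lebesgue_step set0 = 0%E.
Proof. exact: measure0. Qed.

Let lebesgue_step_ge0 A : (0 <= lebesgue_step A)%E.
Proof. exact: measure_ge0. Qed.

Let lebesgue_step_sigma_additive : semi_sigma_additive lebesgue_step.
Proof. exact: measure_semi_sigma_additive. Qed.

HB.instance Definition _ := isMeasure.Build _ _ _ lebesgue_step
  lebesgue_step0 lebesgue_step_ge0 lebesgue_step_sigma_additive.

Let lebesgue_step_sigma_finite : sigma_finite setT lebesgue_step.
Proof.
have /sigma_finiteP[F [FT ndF Foo]] := sigma_finiteT (@lebesgue_measure R).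
have /sigma_finiteP[G [GT ndG Goo]] := sigma_finiteT m.
exists (fun k => @rV_uncons R n @^-1` (F k `*` G k)).
  rewrite -preimage_bigcup [X in _ @^-1` X](_ : _ = setT) ?preimage_setT//.
  rewrite -setXTT FT GT predeqE => -[x y]; split => [[k _ []/= ? ?]|].
    by split; exists k.
  move=> [/= [k _ Fkx] [l _ Gly]]; exists (maxn k l) => //; split.
  - by move: x Fkx; exact/subsetPset/ndF/leq_maxl.
  - by move: y Gly; exact/subsetPset/ndG/leq_maxr.
move=> k; have [mF Fk] := Foo k; have [mG Gk] := Goo k; split.
  rewrite -[X in measurable X]setTI; apply: measurable_rV_uncons => //.
  exact: measurableX.
rewrite /lebesgue_step /pushforward -comp_preimage.
rewrite (_ : _ \o _ = id); last by apply/funext => p /=; exact: rV_consK.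
by rewrite preimage_id product_measure1E// lte_mul_pinfty// ge0_fin_numE.
Qed.

HB.instance Definition _ := Measure_isSigmaFinite.Build _ _ _ lebesgue_step
  lebesgue_step_sigma_finite.

End lebesgue_step.

Fixpoint lebesgueRn (R : realType) (n : nat) :
    {sigma_finite_measure set 'rV[R]_n -> \bar R} :=
  match n return {sigma_finite_measure set 'rV[R]_n -> \bar R} with
  | 0%N => dirac (0 : 'rV[R]_0)
  | n'.+1 => lebesgue_step (lebesgueRn R n')
  end.

(* This product formula characterizes Lebesgue measure on R^n. *)
Lemma lebesgueRn_box (R : realType) (n : nat)
    (A : 'I_n -> set (measurableTypeR R)) :
  (forall i, measurable (A i)) ->
  lebesgueRn R n [set v | forall i, A i (v ord0 i)] =
  (\prod_(i < n) lebesgue_measure (A i))%E.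
Proof.
elim: n A => [|n IHn] A mA /=.
  by rewrite big_ord0 diracE mem_set//= => -[].
have mT : measurable [set v : 'rV[R]_n | forall i, A (lift ord0 i) (v ord0 i)].
  rewrite (_ : [set v | _] =
    \bigcap_(i in [set: 'I_n]) (fun v : 'rV[R]_n => v ord0 i) @^-1` A (lift ord0 i)).
    apply: fin_bigcap_measurable => // i _.
    by rewrite -[X in measurable X]setTI; exact: measurable_coord.
  by apply/seteqP; split => v /= Av i; [move=> _|]; exact: Av.
rewrite big_ord_recl -IHn// -product_measure1E//.
rewrite /lebesgue_step /pushforward; congr (_ _).
apply/seteqP; split => -[x v] /=.
  move=> Av; split => /=.
    by have := Av ord0; rewrite mxE unlift_none.
  by move=> i; have := Av (lift ord0 i); rewrite mxE liftK.
by move=> [Ax Av] i; rewrite mxE; case: unliftP => [j|] ->.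
Qed.

Notation normc := ComplexField.Normc.normc.

Section Euclidean_space.
Context (R : realType) (n : nat).
Implicit Types (x : 'rV[R]_n) (f : 'rV[R]_n -> R) (g : 'rV[R]_n -> R[i])
  (Omega : set 'rV[R]_n).

Local Notation mu := (lebesgueRn R n).

(* The library's [`|x|] on ['rV[R]_n] is the sup norm. *)
Definition enorm x : R := Num.sqrt (\sum_(i < n) x ord0 i ^+ 2).

Definition eball (rho : R) : set 'rV[R]_n := [set x | enorm x < rho].

Definition japanese x : R := Num.sqrt (1 + enorm x ^+ 2).

Definition cmeasurable g :=
  measurable_fun setT (fun x => complex.Re (g x)) /\
  measurable_fun setT (fun x => complex.Im (g x)).

Definition cLnorm (p : \bar R) g : \bar R :=
  Lnorm mu p (fun x => (normc (g x))%:E).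

Definition in_Linfty g := cmeasurable g /\ (cLnorm +oo%E g < +oo)%E.

Definition pderiv (i : 'I_n) f : 'rV[R]_n -> R := 'D_(delta_mx ord0 i) f.

Definition smooth f := forall s : seq 'I_n,
  continuous (foldr pderiv f s) /\
  forall i x, derivable (foldr pderiv f s) x (delta_mx ord0 i).

Definition csmooth g := smooth (fun x => complex.Re (g x)) /\ smooth (fun x => complex.Im (g x)).

Definition compactly_supported_in (T : nmodType) Omega (h : 'rV[R]_n -> T) :=
  compact (closure [set x | h x != 0]) /\
  closure [set x | h x != 0] `<=` Omega.

Definition laplacian f x : R := \sum_(i < n) pderiv i (pderiv i f) x.

Definition claplacian g x : R[i] :=
  Complex (laplacian (fun y => complex.Re (g y)) x) (laplacian (fun y => complex.Im (g y)) x).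

Definition locally_integrable_on Omega f :=
  measurable_fun setT f /\
  forall K, compact K -> K `<=` Omega -> mu.-integrable K (EFin \o f).

Definition divergence (F : 'I_n -> 'rV[R]_n -> R) x : R :=
  \sum_(i < n) pderiv i (F i) x.

(* [W] is the radial derivative (x/|x|) . grad U on R^n \ {0}, in the weak
   sense: [U] is only defined almost everywhere, and the formal adjoint of
   (x/|x|) . grad is phi |-> - div (phi x/|x|). *)
Definition weak_radial_derivative (U W : 'rV[R]_n -> R) :=
  [/\ locally_integrable_on (~` [set 0]) U,
      locally_integrable_on (~` [set 0]) W &
      forall phi : 'rV[R]_n -> R,
        smooth phi -> compactly_supported_in (~` [set 0]) phi ->
        \int[mu]_x (U x * divergence
                            (fun i y => phi y * (y ord0 i / enorm y)) x) =
        - \int[mu]_x (W x * phi x)].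

End Euclidean_space.

(* Main.v *)
Require Import Defs.
From mathcomp Require Import all_boot all_order all_algebra.
From mathcomp Require Import all_classical all_reals all_analysis.
From mathcomp Require Import measurable_realfun ess_sup_inf.
From mathcomp Require Import complex.
From mathcomp Require Import ring lra.
Import Order.TTheory GRing.Theory Num.Theory.
Import numFieldNormedType.Exports.
Set Implicit Arguments.
Unset Strict Implicit.
Unset Printing Implicit Defensive.
Local Open Scope classical_set_scope.
Local Open Scope complex_scope.
Local Open Scope ring_scope.

(** Let [r = |x|], [X = x / r], [N = n - 1], and let [v = exp (tau r) f] for a real
    function [f] supported away from the origin. Conjugation by the weight turns
    [laplacian f + V2 f] into [s - 2 tau d], where
      [s = laplacian v + tau^2 v + V2 v] is the symmetric part,
      [d = p + N v / (2 r)], with [p = X . grad v], is antisymmetric.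
    The square expands as [s^2 + 4 tau^2 d^2 - 4 tau s d], and the proof rests on
    rewriting the cross term [s d] up to divergences, which integrate to zero.
    Polar coordinates are avoided: three explicit fields are used,
      [grad v * p - X |grad v|^2 / 2], [grad v * v / r] and [v^2 X],
    whose divergences are computed in [divergence_stress],
    [divergence_grad_over_r] and [divergence_scaled_radial].

    The weight [tau r] is not strictly convex in the radial direction, so the first
    field only produces the angular part of the gradient, [|grad v|^2 - p^2] over
    [r]. The second field (a virial identity) converts it into
    [(tau^2 + V2) v^2 / r - s v / r] and terms in [p]. After multiplication by
    [4 tau] this gives the main term [4 tau^3 v^2 / r]; the term [4 tau s v / r] is
    absorbed by [s^2], and the radial derivatives by [4 tau^2 d^2], because
    [r >= rho] on the support and [tau] is large ([carleman_pointwise]). The third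
    field takes care of [V2]: the product [V2 v d] is half of [V2 div (v^2 X)], and integrates to
    minus half of the integral of [(d_r V2) v^2], so that a lower bound
    [- c / r] for [d_r V2] costs only [2 tau c v^2 / r].

    For complex [g] the real estimate is applied to both components
    ([real_carleman]). The complex potential [V1] is then treated as a perturbation,
    [|V1|^2 <= c1^2 / r] being of the order of the left-hand side; the slack
    between [4 tau^3] and [tau^3] pays for it.

    Two pieces of analysis support this. Integrals of partial derivatives of
    compactly supported functions vanish ([integral_pderiv], by Fubini and the
    fundamental theorem of calculus along coordinate lines). The functions at hand,
    in particular the test function [v^2] of the weak radial derivative, are smooth:
    smooth functions off the origin form an algebra containing the coordinates,
    [1 / r] and [exp (c r)] ([generated_smooth]), and [smooth_vanishing] extends
    across the origin those that vanish near it. *)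

(** * Borel sets and Lebesgue integrals on R^n *)

Section Borel.
Context (R : realType) (n : nat).
Local Notation mu := (lebesgueRn R n).

Lemma measurable_rV_box (A : 'I_n -> set (measurableTypeR R)) :
  (forall i, measurable (A i)) ->
  measurable [set v : 'rV[R]_n | forall i, A i (v ord0 i)].
Proof.
move=> mA; rewrite (_ : [set v | _] =
    \bigcap_(i in [set: 'I_n]) (fun v : 'rV[R]_n => v ord0 i) @^-1` A i).
  apply: fin_bigcap_measurable => // i _.
  by rewrite -[X in measurable X]setTI; exact: measurable_coord.
by apply/seteqP; split => v /= Av i; [move=> _|]; exact: Av.
Qed.

Lemma rV_norm_le (x : 'rV[R]_n) (M : R) : 0 <= M ->
  (`|x| <= M) <-> forall i, `|x ord0 i| <= M.
Proof.
move=> M0; have xE : `|x| = mx_norm x by [].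
rewrite xE mx_normrE; split => [xM i|xM].
  apply: le_trans xM; apply/bigmax_geP; right.
  by exists (ord0, i).
by apply/bigmax_leP; split => // -[i j] _ /=; rewrite ord1.
Qed.

(** The Borel sigma-algebra is generated by the coordinates, so measurability of
    an open set has to be derived from countability: the set is the union of the
    rational cubes [B q k] (centre [q], radius [1 / k.+1]) that it contains. *)
Lemma open_measurable_rV (O : set 'rV[R]_n) : open O -> measurable O.
Proof.
move=> oO.
pose B (q : 'rV[rat]_n) (k : nat) := [set v : 'rV[R]_n |
  forall i, ball (ratr (q ord0 i) : R) k.+1%:R^-1 (v ord0 i)].
have mB q k : measurable (B q k).
  by apply: (@measurable_rV_box (fun i => ball (ratr (q ord0 i) : R) k.+1%:R^-1)) => i;
    exact: open_measurable (ball_open _ _).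
have -> : O = \bigcup_(p in [set p | B p.1 p.2 `<=` O]) B p.1 p.2.
  apply/seteqP; split => [x Ox|x [p /= pO]]; last exact: pO.
  have /nbhs_ballP[e /= e0 eO] : nbhs x O by exact: open_nbhs_nbhs.
  have [k ke] : exists k : nat, k.+1%:R^-1 < e / 2.
    have /ltr_add_invr[k] : 0 < e / 2 by rewrite divr_gt0.
    by rewrite add0r => ?; exists k.
  have k0 : (0 : R) < k.+1%:R^-1 by rewrite invr_gt0.
  have qP i : exists q : rat, ball (x ord0 i) k.+1%:R^-1 (ratr q : R).
    have /rat_in_itvoo[q] : x ord0 i - k.+1%:R^-1 < x ord0 i + k.+1%:R^-1.
      by rewrite ltrBlDr -addrA ltrDl addr_gt0.
    by rewrite in_itv /= => qP; exists q; rewrite -ball_normE /= ltr_distlC.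
  have [q qx] := choice qP.
  exists (\row_i q i, k) => /=.
    (* The cube has diameter [2 / k.+1 < e] and contains [x]. *)
    move=> y By; apply: eO; rewrite -ball_normE /=.
    apply: (@le_lt_trans _ _ (k.+1%:R^-1 + k.+1%:R^-1)); last by rewrite [ltRHS](splitr e) ltrD.
    apply/rV_norm_le => [|i]; first by rewrite addr_ge0// ltW.
    have := By i; have := qx i; rewrite mxE -!ball_normE /= !mxE.
    move=> h1 h2; rewrite -(subrKA (ratr (q i))).
    by rewrite (le_trans (ler_normD _ _))// ltW// ltrD.
  by move=> i; rewrite mxE; apply: ball_sym; exact: qx.
rewrite bigcup_mkcond; apply: countable_bigcupT_measurable => // p.
by case: ifP.
Qed.

Lemma continuous_measurable_rV (f : 'rV[R]_n -> R) :
  continuous f -> measurable_fun setT f.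
Proof.
move=> /continuousP cf; apply: (measurability _ (RGenOpens.measurableE R)).
move=> _ [_ [a [b ->] <-]]; rewrite setTI; apply: open_measurable_rV.
exact/cf/interval_open.
Qed.

Lemma lebesgueRn_cube_lty (M : R) : 0 <= M ->
  measurable [set x : 'rV[R]_n | `|x| <= M] /\
  (mu [set x : 'rV[R]_n | (`|x| <= M)%R] < +oo)%E.
Proof.
move=> M0; have -> : [set x : 'rV[R]_n | `|x| <= M] =
    [set v | forall i, `[- M, M]%classic (v ord0 i)].
  apply/seteqP; split => x /=.
    by move/(rV_norm_le _ M0) => xM i; rewrite in_itv/= -ler_norml.
  by move=> xM; apply/rV_norm_le => // i; rewrite ler_norml; have := xM i; rewrite in_itv.
split; first by apply: (@measurable_rV_box (fun=> `[- M, M]%classic)) => i;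
  exact: measurable_itv.
rewrite (lebesgueRn_box (A := fun=> `[- M, M]%classic)) => [|i]; last exact: measurable_itv.
rewrite ltey_eq; apply/orP; left.
apply: (@big_ind _ (fun x : \bar R => x \is a fin_num)) => // [x y|i _].
  exact: fin_numM.
by rewrite lebesgue_measure_itv /=; case: ifP.
Qed.

Lemma integrable_compact_support (h : 'rV[R]_n -> R) (M : R) :
  continuous h -> (forall x, M < `|x| -> h x = 0) ->
  mu.-integrable setT (EFin \o h).
Proof.
move=> ch h0; pose M' := Num.max M 0; pose D := [set x : 'rV[R]_n | `|x| <= M'].
have M'0 : 0 <= M' by rewrite le_max lexx orbT.
have [mD Doo] := lebesgueRn_cube_lty M'0.
have -> : EFin \o h = (EFin \o h) \_ D.
  apply/funext => x; rewrite patchE; case: ifPn => //; rewrite notin_setE /D /= => xD.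
  congr EFin; apply: h0; have [//|xM] := ltP M `|x|.
  by exfalso; apply: xD; rewrite le_max xM.
apply/integrable_restrict => //; rewrite setTI.
apply: measurable_bounded_integrable => //.
  by apply: measurable_funTS; exact: continuous_measurable_rV.
have cD : compact D.
  apply: bounded_closed_compact.
    by exists M'; split; [exact: num_real|] => y My x /= /le_trans; apply; exact: ltW.
  have -> : D = (fun x => `|x|) @^-1` [set y | y <= M'] by [].
  by apply: closed_comp => [x _|]; [exact: norm_continuous|exact: closed_le].
have /compact_bounded : compact (h @` D).
  by apply: continuous_compact => //; exact: continuous_subspaceT.
move=> [N [Nr hN]]; exists N; split => // y Ny x Dx.
by apply: (hN y Ny); exists x.
Qed.

End Borel.

(** * The integral of a partial derivative of a compactly supported function *)

(** A map that sends lines of direction [u] to lines of direction [v] transports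
    directional derivatives. With a parametrized line for [phi], this brings in
    one-dimensional calculus; with the embedding of a hyperplane of R^n.+1, it
    makes the induction on the dimension possible. *)
Lemma derivable_along (R : numFieldType) (V V' W : normedModType R)
    (F : V' -> W) (phi : V -> V') (x u : V) (v : V') :
  (forall h : R, phi (h *: u + x) = h *: v + phi x) ->
  (derivable (F \o phi) x u <-> derivable F (phi x) v) /\
  'D_u (F \o phi) x = 'D_v F (phi x).
Proof.
move=> phiE; rewrite /derivable /derive /=.
by have -> : (fun h : R => h^-1 *: (F (phi (h *: u + x)) - F (phi x))) =
  (fun h : R => h^-1 *: (F (h *: v + phi x) - F (phi x)))
  by apply/funext => h; rewrite phiE.
Qed.

Lemma nonexpansive_continuous (R : realFieldType) (V W : normedModType R) (f : V -> W) :
  (forall x y, `|f x - f y| <= `|x - y|) -> continuous f.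
Proof.
move=> fxy x; apply/cvgrPdist_lt => e e0; near=> y.
apply: le_lt_trans (fxy _ _) _; near: y.
by apply/nbhs_ballP; exists e => // y; rewrite -ball_normE.
Unshelve. all: by end_near. Qed.

Lemma pderiv_eq0 (R : realType) n (i : 'I_n) (F : 'rV[R]_n -> R) (M : R) :
  (forall x, M < `|x| -> F x = 0) -> forall x, M < `|x| -> pderiv i F x = 0.
Proof.
move=> F0 x Mx; rewrite /pderiv (@near_eq_derive _ _ _ F (cst 0)) ?derive_cst//.
have oM : open [set y : 'rV[R]_n | M < `|y|].
  rewrite (_ : [set y | _] = (fun y : 'rV[R]_n => `|y|) @^-1` [set r | M < r])//.
  by apply: open_comp => [y _|]; [exact: norm_continuous|exact: open_gt].
by apply: filterS (open_nbhs_nbhs (conj oM Mx)) => y /= /F0.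
Qed.

Lemma integral_derive_compact_support (R : realType) (f : R -> R) (M : R) :
  (forall x, derivable f x 1) -> continuous ('D_1 f) ->
  (forall x, M < `|x| -> f x = 0) ->
  (\int[lebesgue_measure]_x ('D_1 f x)%:E = 0)%E.
Proof.
move=> df cf f0; pose N := Num.max M 0 + 1.
have N0 : 0 < N by rewrite ltr_wpDl// le_max lexx orbT.
have MN x : N <= `|x| -> M < `|x|.
  by apply: lt_le_trans; rewrite ltr_pwDr// le_max lexx.
have NN : - N < N by rewrite gtrN.
have fN : f N = 0 by apply/f0/MN; rewrite ger0_norm// ltW.
have fNN : f (- N) = 0 by apply/f0/MN; rewrite normrN ger0_norm// ltW.
have D0 x : N <= `|x| -> 'D_1 f x = 0.
  move=> /MN Mx; rewrite (@near_eq_derive _ _ _ f (cst 0)) ?derive_cst//.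
  have oM : open [set y : R | M < `|y|].
    rewrite (_ : [set y | _] = (fun y : R => `|y|) @^-1` [set r | M < r])//.
    by apply: open_comp => [y _|]; [exact: norm_continuous|exact: open_gt].
  by apply: filterS (open_nbhs_nbhs (conj oM Mx)) => y /= /f0.
have -> : (fun x => ('D_1 f x)%:E) = (fun x => ('D_1 f x)%:E) \_ `[- N, N].
  apply/funext => x; rewrite patchE; case: ifPn => //.
  rewrite notin_setE /= in_itv /= => /negP; rewrite -ler_norml -ltNge => Nx.
  by rewrite D0// ltW.
rewrite -integral_mkcond (@continuous_FTC2 _ _ f)//.
- by rewrite fN fNN subee.
- exact: continuous_subspaceT.
- have cvf x : f @ x --> f x.
    exact/differentiable_continuous/derivable1_diffP/df.
  by split => [x _|//|]; [exact: df|exact: cvg_at_right_filter|exact: cvg_at_left_filter].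
- by move=> x _; rewrite derive1E.
Qed.

Section slices.
Context (R : realType) (n : nat).
Implicit Types (t : R) (y : 'rV[R]_n) (F : 'rV[R]_n.+1 -> R).

Lemma norm_rV_consl t y : `|t| <= `|rV_cons (t, y)|.
Proof.
have /rV_norm_le := lexx `|rV_cons (t, y)|.
by move=> /(_ (normr_ge0 _))/(_ ord0); rewrite mxE unlift_none.
Qed.

Lemma norm_rV_consr t y : `|y| <= `|rV_cons (t, y)|.
Proof.
apply/rV_norm_le => // i.
have /rV_norm_le := lexx `|rV_cons (t, y)|.
by move=> /(_ (normr_ge0 _))/(_ (lift ord0 i)); rewrite mxE liftK.
Qed.

Lemma rV_consZDl t y (h : R) :
  rV_cons (h *: 1 + t, y) = h *: delta_mx ord0 ord0 + rV_cons (t, y).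
Proof.
apply/rowP => i; rewrite !mxE eqxx /=.
case: unliftP => [j|] -> /=; last by [].
by rewrite mulr0 add0r.
Qed.

Lemma rV_consZDr t y (h : R) (j : 'I_n) :
  rV_cons (t, h *: delta_mx ord0 j + y) =
  h *: delta_mx ord0 (lift ord0 j) + rV_cons (t, y).
Proof.
apply/rowP => i; rewrite !mxE eqxx /=.
case: unliftP => [k|] -> /=; first by rewrite !mxE eqxx /= (inj_eq lift_inj).
by rewrite mulr0 add0r.
Qed.

Lemma continuous_rV_consl y : continuous (fun t : R => rV_cons (t, y)).
Proof.
apply: nonexpansive_continuous => s t; apply/rV_norm_le => // i.
rewrite !mxE; case: unliftP => [j|] _ //=; by rewrite subrr normr0.
Qed.

Lemma continuous_rV_consr t : continuous (fun y => rV_cons (t, y)).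
Proof.
apply: nonexpansive_continuous => y z; apply/rV_norm_le => // i.
rewrite !mxE; case: unliftP => [j|] _ /=; last by rewrite subrr normr0.
by have /rV_norm_le/(_ j) := lexx `|y - z|; rewrite !mxE; apply.
Qed.

Section slice_derivatives.
Variables (i : 'I_n.+1) (F : 'rV[R]_n.+1 -> R).
Hypothesis dF : forall x, derivable F x (delta_mx ord0 i).

Lemma derivable_slicel y : i = ord0 ->
  forall t, derivable (fun t : R => F (rV_cons (t, y))) t 1.
Proof.
move=> iE t; have E h : rV_cons (h *: 1 + t, y) = h *: delta_mx ord0 i + rV_cons (t, y).
  by rewrite rV_consZDl iE.
by have [[_ +] _] := derivable_along F (phi := fun t : R => rV_cons (t, y)) E; apply.
Qed.

Lemma derive_slicel y : i = ord0 ->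
  'D_1 (fun t : R => F (rV_cons (t, y))) = pderiv i F \o (fun t : R => rV_cons (t, y)).
Proof.
move=> iE; apply/funext => t.
have E h : rV_cons (h *: 1 + t, y) = h *: delta_mx ord0 i + rV_cons (t, y).
  by rewrite rV_consZDl iE.
by have [_ ->] := derivable_along F (phi := fun t : R => rV_cons (t, y)) E.
Qed.

Lemma derivable_slicer t j : i = lift ord0 j ->
  forall y, derivable (fun y => F (rV_cons (t, y))) y (delta_mx ord0 j).
Proof.
move=> iE y; have E h : rV_cons (t, h *: delta_mx ord0 j + y) =
    h *: delta_mx ord0 i + rV_cons (t, y).
  by rewrite rV_consZDr iE.
by have [[_ +] _] := derivable_along F (phi := fun y => rV_cons (t, y)) E; apply.
Qed.

Lemma derive_slicer t j : i = lift ord0 j ->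
  pderiv j (fun y => F (rV_cons (t, y))) = pderiv i F \o (fun y => rV_cons (t, y)).
Proof.
move=> iE; apply/funext => y.
have E h : rV_cons (t, h *: delta_mx ord0 j + y) =
    h *: delta_mx ord0 i + rV_cons (t, y).
  by rewrite rV_consZDr iE.
by have [_ +] := derivable_along F (phi := fun y => rV_cons (t, y)) E.
Qed.

End slice_derivatives.

End slices.

(** In the direction of the first coordinate this is Fubini followed by the
    fundamental theorem of calculus on each line; the other directions are
    directions of R^n inside R^n.+1, so that Fubini in the other order reduces them
    to the induction hypothesis. *)
Lemma integral_pderiv (R : realType) (n : nat) (i : 'I_n) (F : 'rV[R]_n -> R)
    (M : R) :
  (forall x, derivable F x (delta_mx ord0 i)) -> continuous (pderiv i F) ->
  (forall x, M < `|x| -> F x = 0) ->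
  (\int[lebesgueRn R n]_x (pderiv i F x)%:E = 0)%E.
Proof.
elim: n i F => [[]//|n IH] i F dF cF F0.
have cF0 := pderiv_eq0 i F0.
pose G := EFin \o pderiv i F.
have mG : measurable_fun setT G.
  by apply/measurable_EFinP; exact: continuous_measurable_rV.
have iG : (lebesgueRn R n.+1).-integrable setT G.
  exact: integrable_compact_support cF cF0.
have iGc : (lebesgue_measure \x lebesgueRn R n)%E.-integrable setT (G \o @rV_cons R n).
  have mGc : measurable_fun setT (G \o @rV_cons R n).
    by apply: measurableT_comp mG _; exact: measurable_rV_cons.
  apply/integrableP; split => //.
  have /integrableP[_] := iG; apply: le_lt_trans.
  rewrite [leRHS](_ : _ = (\int[pushforward (lebesgue_measure \x lebesgueRn R n)
    (@rV_cons R n)]_x `|G x|)%E)//.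
  rewrite ge0_integral_pushforward//; first exact: measurable_rV_cons.
  exact: measurableT_comp.
rewrite (_ : integral _ _ _ = (\int[pushforward (lebesgue_measure \x lebesgueRn R n)%E
  (@rV_cons R n)]_x G x)%E)//.
rewrite integral_pushforward//; last exact: measurable_rV_cons.
rewrite preimage_setT; case: (unliftP ord0 i) => [j|] iE.
- rewrite -integral12_prod_meas1//.
  apply: integral0_eq => t _.
  rewrite /fubini_F /=.
    rewrite -[RHS](IH j (fun y => F (rV_cons (t, y)))).
  + by apply: eq_integral => y _; rewrite (derive_slicer _ _ iE).
  + exact (@derivable_slicer R n i F dF t j iE).
  + rewrite (derive_slicer _ _ iE) => y.
    by apply: continuous_comp; [exact: continuous_rV_consr|exact: cF].
  + by move=> y My; apply: F0; apply: lt_le_trans My (norm_rV_consr _ _).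
- rewrite -integral21_prod_meas1//.
  apply: integral0_eq => y _.
  rewrite /fubini_G /=.
  rewrite -[RHS](@integral_derive_compact_support _ (fun t : R => F (rV_cons (t, y))) M).
  + apply: eq_integral => t _; congr EFin.
    exact (esym (congr1 (fun f => f t) (derive_slicel F y iE))).
  + exact (@derivable_slicel R n i F dF y iE).
  + rewrite (derive_slicel _ _ iE) => t.
    by apply: continuous_comp; [exact: continuous_rV_consl|exact: cF].
  + by move=> t Mt; apply: F0; apply: lt_le_trans Mt (norm_rV_consl _ _).
Qed.

(** * Directional derivatives and their commutation *)

Lemma dist_half (R : realFieldType) (A B C e : R) :
  `|A - C| < e / 2 -> `|B - C| < e / 2 -> `|A - B| <= e.
Proof.
move=> AC BC; rewrite (splitr e) -(subrKA C) (le_trans (ler_normD _ _))//.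
by rewrite lerD ?ltW// distrC.
Qed.

Section directional.
Context (R : realType) (V : normedModType R).
Implicit Types (f g : V -> R) (x v : V).

Lemma is_derive_comp1 (phi : R -> R) g x v (a b : R) :
  is_derive (g x) 1 phi a -> is_derive x v g b ->
  is_derive x v (fun y => phi (g y)) (a * b).
Proof.
move=> dphi [dg gE].
pose L (s : R) := s *: v + x.
have LE h : L (h *: 1 + 0) = h *: v + L 0 by rewrite /L addr0 scale0r add0r [_%:A]mulr1.
have L0 : L 0 = x by rewrite /L scale0r add0r.
have [dgL DgL] := derivable_along g (phi := L) LE.
have [dpL DpL] := derivable_along (fun y => phi (g y)) (phi := L) LE.
have dgL1 : is_derive (0 : R) 1 (g \o L) b.
  by apply: DeriveDef; [apply/dgL; rewrite L0|rewrite DgL L0].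
have dpgL : is_derive (0 : R) 1 (phi \o (g \o L)) (a * b).
  by apply: is_derive1_comp; rewrite /= L0.
case: dpgL => d1 D1; rewrite L0 in dpL DpL.
by apply: DeriveDef; [exact (dpL.1 d1)|rewrite -DpL].
Qed.

Lemma MVT_along f (v : V) x (h : R) : (forall y, derivable f y v) -> 0 < h ->
  exists2 c, 0 < c < h & (f (h *: v + x) - f x) / h = 'D_v f (c *: v + x).
Proof.
move=> df h0; pose L (s : R) := s *: v + x.
have LE s k : L (k *: 1 + s) = k *: v + L s by rewrite /L scalerDl addrA [_%:A]mulr1.
have dL (s : R) : is_derive s (1 : R) (f \o L) ('D_v f (L s)).
  have [dfL DfL] := derivable_along f (phi := L) (LE s).
  by apply: DeriveDef; [exact/dfL|exact: DfL].
have [c|c] := @MVT R (f \o L) (fun s => 'D_v f (L s)) 0 h h0 (fun s _ => dL s).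
  by apply: derivable_within_continuous => s _; case: (dL s).
rewrite in_itv /= subr0 /L scale0r add0r => ch E; exists c => //.
by rewrite E mulfK// gt_eqF.
Qed.

(** Two applications of the mean value theorem. The left-hand side is symmetric in
    [u] and [v], which is what makes the mixed derivatives agree in the limit. *)
Lemma second_difference f (u v : V) x (h : R) :
  (forall y, derivable f y u) -> (forall y, derivable ('D_u f) y v) -> 0 < h ->
  exists c d, [/\ 0 < c < h, 0 < d < h &
    (f (h *: u + (h *: v + x)) - f (h *: u + x) - (f (h *: v + x) - f x)) / h / h
    = 'D_v ('D_u f) (d *: v + (c *: u + x))].
Proof.
move=> df ddf h0; pose g (y : V) := f (h *: v + y) - f y.
have shE (y : V) (k : R) : h *: v + (k *: u + y) = k *: u + (h *: v + y).
  by rewrite addrCA.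
have dg y : is_derive y u g ('D_u f (h *: v + y) - 'D_u f y).
  have [d1 D1] := derivable_along f (phi := fun y => h *: v + y) (shE y).
  apply: is_deriveB; last exact: derivableP.
  by apply: DeriveDef; [exact/d1/df|exact: D1].
have dg' y : derivable g y u by case: (dg y).
have [c ch gE] := MVT_along x dg' h0.
have [d dh DE] := MVT_along (c *: u + x) ddf h0.
exists c, d; split => //; rewrite -DE; congr (_ / _).
have [_ {}DE] := dg (c *: u + x).
by rewrite -[RHS]DE -[RHS]gE /g !(shE x).
Qed.

Lemma continuous_ball (F : V -> R) x e : {for x, continuous F} -> 0 < e ->
  exists2 r : R, 0 < r & forall y, `|x - y| < r -> `|F x - F y| < e.
Proof.
move/cvgrPdist_lt => cF e0; have /nbhs_ballP[r r0 rP] := cF _ e0.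
by exists r => // y xy; apply: (rP y); rewrite -ball_normE.
Qed.

(** Schwarz's theorem: for every small [h] both mixed derivatives, taken at points
    that tend to [x] with [h], equal the same second difference quotient. *)
Lemma deriveC f (u v : V) x :
  (forall y, derivable f y u) -> (forall y, derivable f y v) ->
  (forall y, derivable ('D_u f) y v) -> (forall y, derivable ('D_v f) y u) ->
  {for x, continuous ('D_v ('D_u f))} -> {for x, continuous ('D_u ('D_v f))} ->
  'D_v ('D_u f) x = 'D_u ('D_v f) x.
Proof.
move=> du dv duv dvu cuv cvu; apply/eqP; rewrite -subr_eq0 -normr_le0.
apply/ler_addgt0Pr => e e0; rewrite add0r.
have e20 : 0 < e / 2 by rewrite divr_gt0.
have [r r0 rP] := continuous_ball cuv e20.
have [s s0 sP] := continuous_ball cvu e20.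
(* The points provided by [second_difference] are within [h * N] of [x]. *)
pose N := `|u| + `|v| + 1; have N0 : 0 < N by rewrite ltr_wpDl// addr_ge0.
pose h := Num.min r s / N.
have rs0 : 0 < Num.min r s by rewrite lt_min r0 s0.
have rs t : `|x - t| < Num.min r s -> `|x - t| < r /\ `|x - t| < s.
  by rewrite lt_min => /andP.
have h0 : 0 < h by rewrite divr_gt0.
have hbnd (w z : V) (c d : R) : `|w| + `|z| = `|u| + `|v| -> 0 < c < h -> 0 < d < h ->
    `|x - (d *: z + (c *: w + x))| < Num.min r s.
  move=> wz /andP[c0 ch] /andP[d0 dh].
  rewrite distrC addrA addrK (le_lt_trans (ler_normD _ _))// !normrZ !gtr0_norm//.
  have -> : Num.min r s = h * N by rewrite /h divfK// gt_eqF.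
  by rewrite /N -wz mulrDr mulr1 mulrDr addrC ltr_pwDr// lerD// ler_wpM2r// ltW.
have [c1 [d1 [cP dP E1]]] := second_difference x du duv h0.
have [c2 [d2 [cP' dP' E2]]] := second_difference x dv dvu h0.
have : 'D_v ('D_u f) (d1 *: v + (c1 *: u + x)) = 'D_u ('D_v f) (d2 *: u + (c2 *: v + x)).
  rewrite -E1 -E2; congr (_ / _ / _).
  by rewrite [h *: v + (h *: u + x)]addrCA; ring.
move=> E.
have h1 := rP (d1 *: v + (c1 *: u + x)) (rs _ (hbnd u v c1 d1 erefl cP dP)).1.
have h2 := sP (d2 *: u + (c2 *: v + x)) (rs _ (hbnd v u c2 d2 (addrC _ _) cP' dP')).2.
rewrite -E in h2.
exact: (dist_half h1 h2).
Qed.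
End directional.

(** * Smooth functions on an open set *)

Section smooth_on.
Context (R : realType) (n : nat).
Local Notation V := 'rV[R]_n.
Local Notation e_ i := (delta_mx ord0 i : V).
Implicit Types (f g : V -> R) (x : V) (i : 'I_n) (Omega : set V).

Lemma pderivE i f x (d : R) : is_derive x (e_ i) f d -> pderiv i f x = d.
Proof. by case. Qed.

Lemma is_derive_pderiv i f x :
  derivable f x (e_ i) -> is_derive x (e_ i) f (pderiv i f x : R).
Proof. by move=> df; apply: DeriveDef. Qed.

Lemma is_derive_mul f g x (v : V) (a b : R) :
  is_derive x v f a -> is_derive x v g b ->
  is_derive x v (fun y => f y * g y) (f x * b + g x * a).
Proof.
move=> [df <-] [dg <-]; have := is_deriveM (derivableP df) (derivableP dg).
by [].
Qed.

Lemma is_derive_add f g x (v : V) (a b : R) :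
  is_derive x v f a -> is_derive x v g b -> is_derive x v (fun y => f y + g y) (a + b).
Proof. by move=> df dg; exact: is_deriveD df dg. Qed.

Lemma is_derive_bigsum (h : 'I_n -> V -> R) x (v : V) (dh : 'I_n -> R) :
  (forall i, is_derive x v (h i) (dh i)) ->
  is_derive x v (fun y => \sum_(i < n) h i y) (\sum_(i < n) dh i).
Proof.
move=> dhP; have := is_derive_sum dhP.
by rewrite (_ : (\sum_(i < n) h i) = fun y => \sum_(i < n) h i y)// fct_sumE.
Qed.

Lemma near_eq_pderiv i f g x :
  (\forall y \near x, f y = g y) -> pderiv i f x = pderiv i g x.
Proof. by move=> fg; rewrite /pderiv (near_eq_derive _ fg). Qed.

(** The regularity that one step of differentiation consumes. Derivability in the
    coordinate directions does not imply continuity, hence the conjunction. *)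
Definition regular_at f x :=
  {for x, continuous f} /\ forall i, derivable f x (e_ i).

Lemma near_eq_regular_at f g x :
  (\forall y \near x, f y = g y) -> regular_at f x -> regular_at g x.
Proof.
move=> fg [cf df]; split=> [|i]; last exact: near_eq_derivable fg (df i).
rewrite /prop_for /continuous_at -(nbhs_singleton fg).
exact: cvg_trans (@near_eq_cvg _ _ (nbhs x) _ f g fg) cf.
Qed.

Definition smooth_on Omega f :=
  forall s x, Omega x -> regular_at (foldr (@pderiv R n) f s) x.

Lemma smooth_onT f : smooth f <-> smooth_on setT f.
Proof.
split => [sf s x _|sf s]; first by have [cf df] := sf s; split => [|i]; [exact: cf|exact: df].
by split => [x|i x]; have [] := sf s x I.
Qed.

Lemma smooth_onS Omega Omega' f : Omega' `<=` Omega -> smooth_on Omega f -> smooth_on Omega' f.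
Proof. by move=> OO sf s x /OO; exact: sf. Qed.

Lemma smooth_on_smooth Omega f : smooth f -> smooth_on Omega f.
Proof. by move=> /smooth_onT; exact: smooth_onS. Qed.

Lemma smooth_onU Omega Omega' f :
  smooth_on Omega f -> smooth_on Omega' f -> smooth_on (Omega `|` Omega') f.
Proof. by move=> sf sf' s x [/sf|/sf']; exact. Qed.

Lemma smooth_on_pderiv Omega i f : smooth_on Omega f -> smooth_on Omega (pderiv i f).
Proof. by move=> sf s x Ox; have := sf (rcons s i) x Ox; rewrite foldr_rcons. Qed.

Lemma smooth_on_regular Omega f x : smooth_on Omega f -> Omega x -> regular_at f x.
Proof. by move=> sf; exact: (sf [::]). Qed.

Lemma open_near Omega (P : V -> Prop) x :
  open Omega -> (forall y, Omega y -> P y) -> Omega x -> \forall y \near x, P y.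
Proof. by move=> oO OP Ox; apply: filterS (open_nbhs_nbhs (conj oO Ox)). Qed.

(** Smoothness by coinduction: a class of functions with one-step regularity and
    stable under partial derivatives, up to equality on [Omega], consists of smooth
    functions. Equality on an open set suffices because derivatives are local. *)
Lemma smooth_on_coind Omega (C : set (V -> R)) : open Omega ->
  (forall f, C f -> forall x, Omega x -> regular_at f x) ->
  (forall f i, C f -> exists2 g, C g & forall x, Omega x -> pderiv i f x = g x) ->
  C `<=` smooth_on Omega.
Proof.
move=> oO regC dC f Cf.
have fC s : exists2 g, C g & forall x, Omega x -> foldr (@pderiv R n) f s x = g x.
  elim: s => [|i s [g Cg fg]]; first by exists f.
  have [h Ch gh] := dC g i Cg; exists h => // x Ox /=.
  by rewrite -gh//; apply: near_eq_pderiv; exact: open_near Ox.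
move=> s x Ox; have [g Cg fg] := fC s.
apply: near_eq_regular_at (regC g Cg x Ox).
by apply: open_near Ox => // y /fg.
Qed.

Lemma smooth_on_eq Omega f g : open Omega -> (forall x, Omega x -> f x = g x) ->
  smooth_on Omega f -> smooth_on Omega g.
Proof.
move=> oO fg sf.
apply: (@smooth_on_coind _ [set g | exists2 f, smooth_on Omega f &
  forall x, Omega x -> f x = g x]) => //.
- move=> {sf fg g} g [{}f sf fg] x Ox.
  apply: near_eq_regular_at (smooth_on_regular sf Ox).
  by apply: open_near Ox => // y /fg.
- move=> {sf fg g} g i [{}f sf fg]; exists (pderiv i f).
    by exists (pderiv i f) => //; exact: smooth_on_pderiv.
  move=> x Ox; apply: near_eq_pderiv.
  by apply: open_near Ox => // y /fg.
- by exists f.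
Qed.

(** The algebra generated by [G]. By the product rule it is stable under partial
    derivatives as soon as it contains the partial derivatives of its generators. *)
Inductive generated (G : set (V -> R)) : (V -> R) -> Prop :=
| gen_in f : G f -> generated G f
| gen_cst c : generated G (cst c)
| gen_add f g : generated G f -> generated G g -> generated G (fun x => f x + g x)
| gen_mul f g : generated G f -> generated G g -> generated G (fun x => f x * g x).

Lemma regular_cst c x : regular_at (cst c) x.
Proof. by split => [|i]; [exact: cst_continuous|exact: derivable_cst]. Qed.

Lemma regular_add f g x : regular_at f x -> regular_at g x ->
  regular_at (fun y => f y + g y) x.
Proof.
move=> [cf df] [cg dg]; split => [|i]; first exact: continuousD.
exact: derivableD (df i) (dg i).
Qed.

Lemma regular_mul f g x : regular_at f x -> regular_at g x ->
  regular_at (fun y => f y * g y) x.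
Proof.
move=> [cf df] [cg dg]; split => [|i]; first exact: continuousM.
exact: derivableM (df i) (dg i).
Qed.

Lemma pderiv_add i f g x : regular_at f x -> regular_at g x ->
  pderiv i (fun y => f y + g y) x = pderiv i f x + pderiv i g x.
Proof.
move=> [_ df] [_ dg].
by apply: pderivE; apply: is_derive_add; exact: is_derive_pderiv.
Qed.

Lemma pderiv_mul i f g x : regular_at f x -> regular_at g x ->
  pderiv i (fun y => f y * g y) x = f x * pderiv i g x + g x * pderiv i f x.
Proof.
move=> [_ df] [_ dg].
by apply: pderivE; apply: is_derive_mul; exact: is_derive_pderiv.
Qed.

Lemma pderiv_cst i c x : pderiv i (cst c) x = 0.
Proof. by apply: pderivE; exact: is_derive_cst. Qed.

Lemma generated_smooth Omega (G : set (V -> R)) : open Omega ->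
  (forall f, G f -> forall x, Omega x -> regular_at f x) ->
  (forall f i, G f ->
    exists2 g, generated G g & forall x, Omega x -> pderiv i f x = g x) ->
  generated G `<=` smooth_on Omega.
Proof.
move=> oO regG dG.
have reg f : generated G f -> forall x, Omega x -> regular_at f x.
  elim => {f}[f Gf x Ox|c x _|f g _ rf _ rg x Ox|f g _ rf _ rg x Ox].
  - exact: regG.
  - exact: regular_cst.
  - by apply: regular_add; [exact: rf|exact: rg].
  - by apply: regular_mul; [exact: rf|exact: rg].
apply: smooth_on_coind => // f i; elim => {f}[f Gf|c
  |f g Gf [f' Gf' ff'] Gg [g' Gg' gg']|f g Gf [f' Gf' ff'] Gg [g' Gg' gg']].
- exact: dG.
- by exists (cst 0) => [|x _]; [exact: gen_cst|exact: pderiv_cst].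
- exists (fun x => f' x + g' x); first exact: gen_add.
  by move=> x Ox; rewrite pderiv_add ?ff' ?gg'//; exact: reg.
- exists (fun x => f x * g' x + g x * f' x).
    by apply: gen_add; exact: gen_mul.
  by move=> x Ox; rewrite pderiv_mul ?ff' ?gg'//; exact: reg.
Qed.

Lemma smooth_on_generated Omega : open Omega ->
  generated (smooth_on Omega) `<=` smooth_on Omega.
Proof.
move=> oO; apply: generated_smooth => // [f sf x Ox|f i sf].
  exact: smooth_on_regular Ox.
by exists (pderiv i f) => //; apply: gen_in; exact: smooth_on_pderiv.
Qed.

Lemma smooth_on_cst Omega c : open Omega -> smooth_on Omega (cst c).
Proof. by move=> oO; apply: smooth_on_generated => //; exact: gen_cst. Qed.

Lemma smooth_on_add Omega f g : open Omega -> smooth_on Omega f -> smooth_on Omega g ->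
  smooth_on Omega (fun x => f x + g x).
Proof.
by move=> oO sf sg; apply: smooth_on_generated => //; apply: gen_add; exact: gen_in.
Qed.

Lemma smooth_on_mul Omega f g : open Omega -> smooth_on Omega f -> smooth_on Omega g ->
  smooth_on Omega (fun x => f x * g x).
Proof.
by move=> oO sf sg; apply: smooth_on_generated => //; apply: gen_mul; exact: gen_in.
Qed.

Lemma smooth_on_sum Omega (I : Type) (r : seq I) (h : I -> V -> R) : open Omega ->
  (forall k, smooth_on Omega (h k)) -> smooth_on Omega (fun x => \sum_(k <- r) h k x).
Proof.
move=> oO sh; elim: r => [|k r IH].
  under [X in smooth_on _ X]eq_fun do rewrite big_nil; exact: smooth_on_cst.
under [X in smooth_on _ X]eq_fun do rewrite big_cons.
exact: smooth_on_add.
Qed.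

(** In the divergence of [grad v * (X . grad v) - X |grad v|^2 / 2] the second
    derivatives of [v], apart from the Laplacian, cancel by this symmetry. *)
Lemma pderivC i j f x : smooth f -> pderiv i (pderiv j f) x = pderiv j (pderiv i f) x.
Proof.
move=> sf; apply: deriveC => [y|y|y|y||].
- exact: (sf [::]).2.
- exact: (sf [::]).2.
- exact: (sf [:: j]).2.
- exact: (sf [:: i]).2.
- exact: (sf [:: i; j]).1.
- exact: (sf [:: j; i]).1.
Qed.

End smooth_on.

(** * Smoothness of the radial weights off the origin *)

Section radial_weights.
Context (R : realType) (n : nat).
Local Notation V := 'rV[R]_n.
Local Notation e_ i := (delta_mx ord0 i : V).
Implicit Types (x : V) (i j : 'I_n).

Lemma enorm_ge0 x : 0 <= enorm x.
Proof. exact: sqrtr_ge0. Qed.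

Lemma enorm_sqr x : enorm x ^+ 2 = \sum_(i < n) x ord0 i ^+ 2.
Proof. by rewrite sqr_sqrtr// sumr_ge0// => i _; rewrite sqr_ge0. Qed.

Lemma coord_regular j x : regular_at (fun y : V => y ord0 j) x /\
  forall i, is_derive x (e_ i) (fun y : V => y ord0 j) ((j == i)%:R : R).
Proof.
have dj i : is_derive x (e_ i) (fun y : V => y ord0 j) ((j == i)%:R : R).
  have E (h : R) : (h *: e_ i + x) ord0 j = h *: ((j == i)%:R : R) + x ord0 j.
    by rewrite !mxE eqxx.
  have [[_ d] D] := derivable_along (id : R -> R) (phi := fun y : V => y ord0 j) E.
  apply: DeriveDef; first by apply: d; exact: derivable_id.
  by rewrite D derive_id.
split => //; split => [|i]; first exact: coord_continuous.
by case: (dj i).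
Qed.

Lemma regular_bigsum (I : Type) (r : seq I) (h : I -> V -> R) x :
  (forall k, regular_at (h k) x) -> regular_at (fun y => \sum_(k <- r) h k y) x.
Proof.
move=> rh; elim: r => [|k r IH].
  under [X in regular_at X]eq_fun do rewrite big_nil; exact: regular_cst.
under [X in regular_at X]eq_fun do rewrite big_cons.
exact: regular_add.
Qed.

Lemma is_derive_sumsq i x : is_derive x (e_ i)
  (fun y : V => \sum_(j < n) y ord0 j ^+ 2) (2 * x ord0 i).
Proof.
rewrite [X in is_derive _ _ _ X](_ : _ =
    \sum_(j < n) (x ord0 j * ((j == i)%:R : R) + x ord0 j * ((j == i)%:R : R))).
  apply: is_derive_bigsum => j; under eq_fun do rewrite expr2.
  by apply: is_derive_mul; exact: (coord_regular j x).2.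
rewrite (bigD1 i)//= eqxx big1 => [|j /negbTE ->]; last by rewrite mulr0 addr0.
by rewrite mulr1 addr0 mulr_natl mulr2n.
Qed.

Lemma continuous_enorm : continuous (@enorm R n).
Proof.
move=> x; apply: continuous_comp; last exact: sqrt_continuous.
apply: (regular_bigsum (h := fun i (y : V) => y ord0 i ^+ 2) (index_enum _) _).1 => i.
by under [X in regular_at X]eq_fun do rewrite expr2;
  apply: regular_mul; exact: (coord_regular i x).1.
Qed.

Lemma is_derive_enorm i x : 0 < enorm x ->
  is_derive x (e_ i) (@enorm R n) (x ord0 i / enorm x).
Proof.
move=> x0.
have s0 : 0 < \sum_(j < n) x ord0 j ^+ 2 by rewrite -enorm_sqr exprn_gt0.
have := is_derive_comp1 (is_derive1_sqrt s0) (is_derive_sumsq i x).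
rewrite (_ : _^-1 * _ = x ord0 i / enorm x)//.
by rewrite -[Num.sqrt _]/(enorm x); field; rewrite gt_eqF.
Qed.

Lemma is_derive_enormV i x : 0 < enorm x ->
  is_derive x (e_ i) (fun y : V => (enorm y)^-1) (- (x ord0 i / enorm x ^+ 3)).
Proof.
move=> x0; have xn0 : enorm x != 0 by rewrite gt_eqF.
have dinv : is_derive (enorm x) 1 (fun r : R => r^-1) (- enorm x ^- 2).
  have := @is_deriveV R id (enorm x) 1 1 xn0 (is_derive_id _ _).
  by rewrite /GRing.scale /= mulr1.
have := is_derive_comp1 dinv (is_derive_enorm i x0).
rewrite (_ : _ * _ = - (x ord0 i / enorm x ^+ 3))//.
by field.
Qed.

Lemma is_derive_expR_enorm (c : R) i x : 0 < enorm x ->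
  is_derive x (e_ i) (fun y : V => expR (c * enorm y))
    (c * (x ord0 i / enorm x) * expR (c * enorm x)).
Proof.
move=> x0; rewrite mulrC.
have dc : is_derive x (e_ i) (fun y : V => c * enorm y) (c * (x ord0 i / enorm x)).
  have := is_derive_mul (is_derive_cst c x (e_ i)) (is_derive_enorm i x0).
  by rewrite /= mulr0 addr0.
exact: (is_derive_comp1 (is_derive_expR _) dc).
Qed.

Definition punctured : set V := [set x | 0 < enorm x].

Lemma open_punctured : open punctured.
Proof.
rewrite (_ : punctured = @enorm R n @^-1` [set r | 0 < r])//.
by apply: open_comp => [x _|]; [exact: continuous_enorm|exact: open_gt].
Qed.

Lemma open_eball (rho : R) : open (@eball R n rho).
Proof.
rewrite (_ : eball rho = @enorm R n @^-1` [set r | r < rho])//.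
by apply: open_comp => [x _|]; [exact: continuous_enorm|exact: open_lt].
Qed.

(** Generators of an algebra closed under partial derivatives off the origin:
    [d_i x_j] is constant, [d_i r^-1 = - x_i r^-3] and
    [d_i exp (c r) = c x_i r^-1 exp (c r)]. *)
Let radial : set (V -> R) := [set f | [\/ exists j, f = (fun y : V => y ord0 j),
  f = (fun y => (enorm y)^-1) | exists c, f = (fun y => expR (c * enorm y))]].

Let radial_smooth : generated radial `<=` smooth_on punctured.
Proof.
have gcoord j : generated radial (fun y : V => y ord0 j).
  by apply: gen_in; constructor 1; exists j.
have genormV : generated radial (fun y : V => (enorm y)^-1).
  by apply: gen_in; constructor 2.
apply: generated_smooth; first exact: open_punctured.
- move=> _ [[j ->]|->|[c ->]] x x0.
  + exact: (coord_regular j x).1.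
  + split => [|i]; last by case: (is_derive_enormV i x0).
    apply: continuousV; [by rewrite gt_eqF|exact: continuous_enorm].
  + split => [|i]; last by case: (is_derive_expR_enorm c i x0).
    apply: (@continuous_comp _ _ _ (fun y : V => c * enorm y)); last exact: continuous_expR.
    by apply: continuousM; [exact: cst_continuous|exact: continuous_enorm].
- move=> _ i [[j ->]|->|[c ->]].
  + exists (cst ((j == i)%:R : R)); first exact: gen_cst.
    by move=> x _; apply: pderivE; exact: (coord_regular j x).2.
  + exists (fun y : V => -1 * (y ord0 i * ((enorm y)^-1 * ((enorm y)^-1 * (enorm y)^-1)))).
      apply: gen_mul; first exact: (gen_cst _ (-1)).
      by apply: gen_mul => //; apply: gen_mul => //; exact: gen_mul.
    move=> x x0; rewrite (pderivE (is_derive_enormV i x0)).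
    by rewrite mulN1r -!invfM -!expr2 -exprS.
  + exists (fun y : V => c * (y ord0 i * (enorm y)^-1) * expR (c * enorm y)).
      apply: gen_mul; last by apply: gen_in; constructor 3; exists c.
      by apply: gen_mul; [exact: gen_cst|exact: gen_mul].
    by move=> x x0; apply: pderivE; exact: is_derive_expR_enorm.
Qed.

Lemma smooth_on_coord j : smooth_on punctured (fun y : V => y ord0 j).
Proof. by apply: radial_smooth; apply: gen_in; constructor 1; exists j. Qed.

Lemma smooth_on_enormV : smooth_on punctured (fun y : V => (enorm y)^-1).
Proof. by apply: radial_smooth; apply: gen_in; constructor 2. Qed.

Lemma smooth_on_expR_enorm c : smooth_on punctured (fun y : V => expR (c * enorm y)).
Proof. by apply: radial_smooth; apply: gen_in; constructor 3; exists c. Qed.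

(** The singularity of the weights at the origin is harmless for functions that
    vanish near it. *)
Lemma smooth_vanishing (rho : R) (f : V -> R) : 0 < rho ->
  smooth_on punctured f -> (forall x, enorm x < rho -> f x = 0) -> smooth f.
Proof.
move=> rho0 sf f0; apply/smooth_onT.
have : smooth_on (punctured `|` eball rho) f.
  apply: smooth_onU => //; apply: (@smooth_on_eq _ _ _ (cst 0)).
  - exact: open_eball.
  - by move=> x /f0.
  - by apply: smooth_on_cst; exact: open_eball.
apply: smooth_onS => x _; rewrite /setU /punctured /eball /=.
by case: (ltP 0 (enorm x)) => [|x0]; [left|right; exact: le_lt_trans x0 _].
Qed.

End radial_weights.

(** * Divergences of radial vector fields *)

Section radial_fields.
Context (R : realType) (n : nat).
Local Notation V := 'rV[R]_n.
Local Notation N := (n%:R - 1 : R).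
Implicit Types (x y : V) (i j : 'I_n) (v f phi : V -> R).

Definition radial_dir i y : R := y ord0 i / enorm y.

Definition radial_derivative v x : R := \sum_(i < n) radial_dir i x * pderiv i v x.

Definition grad_sq v x : R := \sum_(i < n) pderiv i v x ^+ 2.

Lemma regular_punctured f x : smooth_on (@punctured R n) f -> 0 < enorm x -> regular_at f x.
Proof. by move=> sf x0; exact: (smooth_on_regular sf x0). Qed.

Lemma smooth_on_radial_dir i : smooth_on (@punctured R n) (radial_dir i).
Proof.
apply: smooth_on_mul; [exact: open_punctured|exact: smooth_on_coord|].
exact: smooth_on_enormV.
Qed.

Lemma regular_enormV x : 0 < enorm x -> regular_at (fun y : V => (enorm y)^-1) x.
Proof. exact: regular_punctured (@smooth_on_enormV R n). Qed.

Lemma regular_radial_dir i x : 0 < enorm x -> regular_at (radial_dir i) x.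
Proof. exact: regular_punctured (smooth_on_radial_dir i). Qed.

Lemma pderiv_bigsum (h : 'I_n -> V -> R) i x : (forall j, regular_at (h j) x) ->
  pderiv i (fun y => \sum_(j < n) h j y) x = \sum_(j < n) pderiv i (h j) x.
Proof.
move=> rh; apply: pderivE; apply: is_derive_bigsum => j.
by apply: is_derive_pderiv; case: (rh j).
Qed.

Lemma pderiv_enormV i x : 0 < enorm x ->
  pderiv i (fun y : V => (enorm y)^-1) x = - (radial_dir i x / enorm x ^+ 2).
Proof.
move=> x0; rewrite (pderivE (is_derive_enormV i x0)) /radial_dir.
by field; rewrite gt_eqF.
Qed.

Lemma pderiv_expR_enorm (c : R) i x : 0 < enorm x ->
  pderiv i (fun y : V => expR (c * enorm y)) x = c * radial_dir i x * expR (c * enorm x).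
Proof. by move=> x0; exact: pderivE (is_derive_expR_enorm c i x0). Qed.

(** The Hessian of [r = |x|] is the projection orthogonal to [x], divided by [r]. *)
Lemma pderiv_radial_dir i j x : 0 < enorm x ->
  pderiv i (radial_dir j) x =
  ((j == i)%:R - radial_dir i x * radial_dir j x) / enorm x.
Proof.
move=> x0; have [rj dj] := coord_regular j x.
rewrite (pderiv_mul i rj (regular_enormV x0)).
rewrite (pderivE (dj i)) pderiv_enormV// /radial_dir.
by field; rewrite gt_eqF.
Qed.

Lemma radial_dir_sq x : 0 < enorm x -> \sum_(i < n) radial_dir i x ^+ 2 = 1.
Proof.
move=> x0; rewrite /radial_dir; under eq_bigr do rewrite expr_div_n.
by rewrite -mulr_suml -enorm_sqr divff// sqrf_eq0 gt_eqF.
Qed.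

Lemma divergence_radial_dir x : 0 < enorm x ->
  \sum_(i < n) pderiv i (radial_dir i) x = N / enorm x.
Proof.
move=> x0; under eq_bigr do rewrite pderiv_radial_dir// eqxx -expr2.
by rewrite -mulr_suml sumrB radial_dir_sq// sumr_const card_ord.
Qed.

Lemma divergence_scaled_radial phi x : regular_at phi x -> 0 < enorm x ->
  divergence (fun i y => phi y * (y ord0 i / enorm y)) x =
  radial_derivative phi x + phi x * (N / enorm x).
Proof.
move=> rphi x0; rewrite -divergence_radial_dir// /divergence mulr_sumr -big_split /=.
by apply: eq_bigr => i _; rewrite (pderiv_mul i rphi (regular_radial_dir i x0)) addrC.
Qed.

Lemma radial_derivative_sq v x : regular_at v x ->
  radial_derivative (fun y => v y * v y) x = 2 * (v x * radial_derivative v x).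
Proof.
move=> rv; rewrite /radial_derivative !mulr_sumr; apply: eq_bigr => i _.
by rewrite (pderiv_mul i rv rv); ring.
Qed.

Lemma pderivZ (c : R) i f x : regular_at f x ->
  pderiv i (fun y => c * f y) x = c * pderiv i f x.
Proof.
by move=> rf; rewrite (pderiv_mul i (regular_cst c x) rf) pderiv_cst mulr0 addr0.
Qed.

Section smooth_v.
Variables (v : V -> R) (x : V).
Hypotheses (sv : smooth v) (x0 : 0 < enorm x).

Let rv : regular_at v x.
Proof. by move/smooth_onT : sv => /(_ [::] x I). Qed.

Let rvi i : regular_at (pderiv i v) x.
Proof. by move/smooth_onT : sv => /(_ [:: i] x I). Qed.

Let rdir i : regular_at (radial_dir i) x := regular_radial_dir i x0.

Let renormV : regular_at (fun y : V => (enorm y)^-1) x := regular_enormV x0.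

Let p := radial_derivative v x.
Let q := grad_sq v x.
Let r := enorm x.

(** Integrated, this is the virial identity: it expresses [|grad v|^2 / r] by
    [v * laplacian v / r]. *)
Lemma divergence_grad_over_r :
  divergence (fun i y => pderiv i v y * ((enorm y)^-1 * v y)) x =
  laplacian v x * (v x / r) + q / r - v x * p / r ^+ 2.
Proof.
rewrite /q /p /grad_sq /radial_derivative /laplacian /divergence.
rewrite !mulr_suml mulr_sumr mulr_suml -big_split -sumrB /=.
apply: eq_bigr => i _; rewrite (pderiv_mul i (rvi i) (regular_mul renormV rv)).
rewrite (pderiv_mul i renormV rv).
by rewrite pderiv_enormV// -/r; field; rewrite gt_eqF.
Qed.

Lemma pderiv_radial_derivative i :
  pderiv i (radial_derivative v) x =
  (pderiv i v x - radial_dir i x * p) / r +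
  \sum_(j < n) radial_dir j x * pderiv i (pderiv j v) x.
Proof.
rewrite (pderiv_bigsum i (fun j => regular_mul (rdir j) (rvi j))).
under eq_bigr => j _.
  rewrite (pderiv_mul i (rdir j) (rvi j)) (pderiv_radial_dir i j x0); over.
rewrite big_split /= addrC; congr (_ + _).
rewrite /p /radial_derivative mulr_sumr.
have -> : pderiv i v x = \sum_(j < n) (j == i)%:R * pderiv j v x.
  rewrite (bigD1 i)//= eqxx mul1r big1 ?addr0// => j /negbTE ->.
  by rewrite mul0r.
rewrite -sumrB mulr_suml; apply: eq_bigr => j _; rewrite -/r.
by field; rewrite gt_eqF.
Qed.

Lemma pderiv_grad_sq i :
  pderiv i (grad_sq v) x = 2 * \sum_(j < n) pderiv j v x * pderiv i (pderiv j v) x.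
Proof.
rewrite (_ : grad_sq v = fun y => \sum_(j < n) pderiv j v y * pderiv j v y); last first.
  by apply/funext => y; apply: eq_bigr => j _; rewrite expr2.
rewrite (pderiv_bigsum i (fun j => regular_mul (rvi j) (rvi j))).
rewrite mulr_sumr; apply: eq_bigr => j _.
by rewrite (pderiv_mul i (rvi j) (rvi j)); ring.
Qed.

Lemma regular_radial_derivative : regular_at (radial_derivative v) x.
Proof.
exact: (regular_bigsum _ (fun j => regular_mul (rdir j) (rvi j))).
Qed.

Lemma regular_grad_sq : regular_at (grad_sq v) x.
Proof.
apply: regular_bigsum => j; under [X in regular_at X]eq_fun do rewrite expr2.
exact: (regular_mul (rvi j) (rvi j)).
Qed.

(** The Rellich identity for the multiplier [p = X . grad v]. The term
    [(q - p ^+ 2) / r] is the angular part of the gradient and comes from the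
    Hessian of [r]; the last one comes from [div X = (n - 1) / r]. *)
Lemma divergence_stress :
  divergence (fun i y => pderiv i v y * radial_derivative v y
     + (- (1 / 2)) * (radial_dir i y * grad_sq v y)) x =
  laplacian v x * p + (q - p ^+ 2) / r - 1 / 2 * (N / r) * q.
Proof.
have rp := regular_radial_derivative; have rq := regular_grad_sq.
rewrite /divergence.
under eq_bigr => i _.
  rewrite (pderiv_add i (regular_mul (rvi i) rp)
    (regular_mul (regular_cst (- (1 / 2)) x) (regular_mul (rdir i) rq))).
  rewrite (pderiv_mul i (rvi i) rp) (pderivZ _ i (regular_mul (rdir i) rq)).
  rewrite (pderiv_mul i (rdir i) rq) pderiv_radial_derivative pderiv_grad_sq.
  over.
(* [A] and [B] collect the second derivatives; they cancel by symmetry of the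
   Hessian of [v]. *)
pose A := \sum_(i < n) \sum_(j < n) pderiv i v x * (radial_dir j x * pderiv i (pderiv j v) x).
pose B := \sum_(i < n) \sum_(j < n) radial_dir i x * (pderiv j v x * pderiv i (pderiv j v) x).
have AB : A = B.
  rewrite /A exchange_big; apply: eq_bigr => i _; apply: eq_bigr => j _.
  by rewrite (pderivC i j)//; ring.
transitivity (laplacian v x * p + (q - p * p) / r + A - B - 1 / 2 * (N / r) * q); last first.
  by rewrite AB; ring.
have -> : A = \sum_(i < n) pderiv i v x * \sum_(j < n) radial_dir j x * pderiv i (pderiv j v) x.
  by apply: eq_bigr => i _; rewrite mulr_sumr.
have -> : B = \sum_(i < n) radial_dir i x * \sum_(j < n) pderiv j v x * pderiv i (pderiv j v) x.
  by apply: eq_bigr => i _; rewrite mulr_sumr.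
have -> : laplacian v x * p = \sum_(i < n) pderiv i (pderiv i v) x * p.
  by rewrite mulr_suml.
have -> : (q - p * p) / r =
    \sum_(i < n) (pderiv i v x ^+ 2 - radial_dir i x * pderiv i v x * p) / r.
  by rewrite -mulr_suml sumrB -mulr_suml.
have -> : 1 / 2 * (N / r) * q = \sum_(i < n) 1 / 2 * pderiv i (radial_dir i) x * q.
  by rewrite -mulr_suml -mulr_sumr divergence_radial_dir.
rewrite -!big_split -!sumrB; apply: eq_bigr => i _ /=.
by rewrite -/p -/q; field; rewrite gt_eqF.
Qed.

End smooth_v.
End radial_fields.

(** * Conjugation of the Laplacian by the exponential weight *)

Section conjugation.
Context (R : realType) (n : nat).
Local Notation V := 'rV[R]_n.
Local Notation N := (n%:R - 1 : R).
Implicit Types (x y : V) (i : 'I_n) (f : V -> R).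

Definition weighted (tau : R) f y : R := expR (tau * enorm y) * f y.

Lemma pderiv_weighted tau f i y : smooth f -> 0 < enorm y ->
  pderiv i (weighted tau f) y =
  expR (tau * enorm y) * pderiv i f y + tau * (radial_dir i y * weighted tau f y).
Proof.
move=> /smooth_onT/(_ [::] y I) rf y0.
have rE := regular_punctured (smooth_on_expR_enorm tau) y0.
by rewrite (pderiv_mul i rE rf) pderiv_expR_enorm// /weighted /=; ring.
Qed.

(** Differentiate [d_i v = exp (tau r) d_i f + tau X_i v] once more and eliminate
    the first derivatives of [f] in favour of those of [v]. *)
Lemma laplacian_weighted tau f x : smooth f -> smooth (weighted tau f) -> 0 < enorm x ->
  laplacian (weighted tau f) x = expR (tau * enorm x) * laplacian f x
    + 2 * tau * radial_derivative (weighted tau f) x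
    - tau ^+ 2 * weighted tau f x + tau * (N / enorm x) * weighted tau f x.
Proof.
move=> sf sv x0; set v := weighted tau f.
have rE := regular_punctured (smooth_on_expR_enorm tau) x0.
have rv : regular_at v x by move/smooth_onT : sv => /(_ [::] x I).
have rfi i : regular_at (pderiv i f) x by move/smooth_onT : sf => /(_ [:: i] x I).
have step i : pderiv i (pderiv i v) x =
    expR (tau * enorm x) * pderiv i (pderiv i f) x
    + 2 * tau * (radial_dir i x * pderiv i v x)
    - tau ^+ 2 * v x * (radial_dir i x ^+ 2) + tau * v x * pderiv i (radial_dir i) x.
  have rd := regular_radial_dir i x0.
  have -> : pderiv i (pderiv i v) x = pderiv i (fun y =>
      expR (tau * enorm y) * pderiv i f y + tau * (radial_dir i y * v y)) x.
    apply: near_eq_pderiv; apply: (open_near (@open_punctured R n)) x0 => y y0.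
    exact: pderiv_weighted.
  rewrite (pderiv_add i (regular_mul rE (rfi i))
    (regular_mul (regular_cst tau x) (regular_mul rd rv))).
  rewrite (pderiv_mul i rE (rfi i)) (pderivZ _ i (regular_mul rd rv)).
  rewrite (pderiv_mul i rd rv) pderiv_expR_enorm//.
  have -> : pderiv i v x =
      expR (tau * enorm x) * pderiv i f x + tau * (radial_dir i x * v x).
    exact: pderiv_weighted.
  by rewrite /=; ring.
transitivity (\sum_(i < n) (expR (tau * enorm x) * pderiv i (pderiv i f) x
    + 2 * tau * (radial_dir i x * pderiv i v x)
    - tau ^+ 2 * v x * (radial_dir i x ^+ 2) + tau * v x * pderiv i (radial_dir i) x)).
  by apply: eq_bigr => i _; exact: step.
rewrite big_split sumrB big_split /= -!mulr_sumr (divergence_radial_dir x0).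
by rewrite (radial_dir_sq x0) -/(laplacian f x) -/(radial_derivative v x); ring.
Qed.

Lemma smooth_weighted tau (rho : R) f : 0 < rho -> smooth f ->
  (forall x, enorm x < rho -> f x = 0) -> smooth (weighted tau f).
Proof.
move=> rho0 sf f0; apply: (smooth_vanishing rho0) => [|x /f0 fx].
  apply: smooth_on_mul; [exact: open_punctured|exact: smooth_on_expR_enorm|].
  exact: smooth_on_smooth.
by rewrite /weighted fx mulr0.
Qed.

End conjugation.

(** * The pointwise Carleman estimate *)

Section pointwise_estimate.
Context (R : realType).

(** The left-hand side is [(s - 2 t d) ^+ 2], for the symmetric part [s] and the
    antisymmetric part [- 2 t d] of the conjugated operator, and the three
    divergences come from its cross term [- 4 t s d]. The angular gradient
    [(q - p ^+ 2) / r] of [div1] does not appear: [div2] exchanges [q / r] for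
    [(t ^+ 2 + U) v ^+ 2 / r - s v / r + v p / r ^+ 2], which is the source of the
    main term [4 t ^+ 3 v ^+ 2 / r]. *)
Lemma carleman_identity (t r N U v p q dv : R) : 0 < r ->
  let div1 := dv * p + (q - p ^+ 2) / r - 1 / 2 * (N / r) * q in
  let div2 := dv * (v / r) + q / r - v * p / r ^+ 2 in
  let div3 := 2 * (v * p) + v ^+ 2 * (N / r) in
  let s := dv + t ^+ 2 * v + U * v in
  let d := p + N * v / (2 * r) in
  (dv - 2 * t * p + t ^+ 2 * v - t * (N / r) * v + U * v) ^+ 2 =
  s ^+ 2 + 4 * t ^+ 2 * d ^+ 2 - 4 * t * (s * v / r)
  + 4 * t * (t ^+ 2 + U) * (v ^+ 2 / r) - 4 * t * (p ^+ 2 / r)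
  - 4 * t * ((N / 2 - 1) * v * p / r ^+ 2)
  - 4 * t * (div1 + (N / 2 - 1) * div2) - 2 * t ^+ 3 * div3 - 2 * t * U * div3.
Proof. by move=> r0 /=; field; rewrite gt_eqF. Qed.

(** With [K = N / 2 - 1], the error terms [p^2 / r] and [K v p / r^2] together cost
    at most [3 d^2 / rho + radial_error_const N * (v^2 / r) / rho^2]; see [e4] in
    [carleman_pointwise]. *)
Definition radial_error_const (N : R) : R := 3 / 4 * N ^+ 2 + (N / 2 - 1) ^+ 2 / 2.

(** The error [4 t s v / r] is absorbed by [s^2], and the radial derivatives by
    [4 t^2 d^2], which is where [3 / rho <= t] enters. The combination of the divergences and
    [W] integrates to zero once [W] is the radial derivative of [U]. *)
Lemma carleman_pointwise (t rho r N M c2 U W v p q dv div1 div2 div3 : R) :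
  0 < rho -> rho <= r -> 3 / rho <= t -> `|U| <= M -> - c2 / r <= W ->
  div1 = dv * p + (q - p ^+ 2) / r - 1 / 2 * (N / r) * q ->
  div2 = dv * (v / r) + q / r - v * p / r ^+ 2 ->
  div3 = 2 * (v * p) + v ^+ 2 * (N / r) ->
  (4 * t ^+ 3 - 4 * t ^+ 2 / rho - 4 * t * M - 2 * t * c2
    - 4 * t * radial_error_const N / rho ^+ 2) * (v ^+ 2 / r)
  + (- 4 * t * (div1 + (N / 2 - 1) * div2) - 2 * t ^+ 3 * div3
  - 2 * t * (U * div3 + W * v ^+ 2))
  <= (dv - 2 * t * p + t ^+ 2 * v - t * (N / r) * v + U * v) ^+ 2.
Proof.
move=> rho0 rr trho UM Wc E1 E2 E3.
have r0 : 0 < r by exact: lt_le_trans rho0 rr.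
have t0 : 0 < t by rewrite (lt_le_trans _ trho)// divr_gt0.
rewrite (carleman_identity t N U v p q dv r0) /= -E1 -E2 -E3 {E1 E2 E3}.
set s := dv + _ + _; set d := p + _; set K := N / 2 - 1.
have w0 : 0 <= v ^+ 2 / r by rewrite divr_ge0 ?sqr_ge0// ltW.
have ir : r^-1 <= rho^-1 by rewrite lef_pV2.
have ir0 : 0 <= r^-1 by rewrite invr_ge0 ltW.
have irho0 : 0 <= rho^-1 by rewrite invr_ge0 ltW.
have ir2 : r^-1 ^+ 2 <= rho^-1 ^+ 2 by rewrite ler_pXn2r ?nnegrE.
(* Complete the square: [s^2 - 4 t s v / r >= - 4 t^2 v^2 / r^2]. *)
have e1 : - (4 * t ^+ 2 / rho * (v ^+ 2 / r)) <= s ^+ 2 - 4 * t * (s * v / r).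
  have h : 4 * t ^+ 2 * (v ^+ 2 / r) * r^-1 <= 4 * t ^+ 2 * (v ^+ 2 / r) * rho^-1.
    by rewrite ler_wpM2l// mulr_ge0// mulr_ge0// sqr_ge0.
  have h2 : 0 <= (s - 2 * t * (v / r)) ^+ 2 by exact: sqr_ge0.
  have -> : s ^+ 2 - 4 * t * (s * v / r) =
    (s - 2 * t * (v / r)) ^+ 2 - 4 * t ^+ 2 * (v ^+ 2 / r) * r^-1 by ring.
  have -> : 4 * t ^+ 2 / rho * (v ^+ 2 / r) = 4 * t ^+ 2 * (v ^+ 2 / r) * rho^-1 by ring.
  lra.
have e2 : - (4 * t * M * (v ^+ 2 / r)) <= 4 * t * U * (v ^+ 2 / r).
  rewrite -mulNr ler_wpM2r// -mulrN ler_wpM2l ?mulr_ge0 ?(ltW t0)//.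
  by move: UM; rewrite ler_norml => /andP[].
have e3 : - (2 * t * c2 * (v ^+ 2 / r)) <= 2 * t * (W * v ^+ 2).
  have -> : - (2 * t * c2 * (v ^+ 2 / r)) = 2 * t * ((- c2 / r) * v ^+ 2) by ring.
  by rewrite ler_wpM2l ?mulr_ge0 ?(ltW t0)// ler_wpM2r// sqr_ge0.
(* Here [p = d - N v / (2 r)] trades the radial derivative for [d]. *)
have e4 : - (4 * t * radial_error_const N / rho ^+ 2 * (v ^+ 2 / r)) <=
    4 * t ^+ 2 * d ^+ 2 - 4 * t * (p ^+ 2 / r) - 4 * t * (K * v * p / r ^+ 2).
  have h1 : 3 / 2 * (p ^+ 2 / r) <= 3 * d ^+ 2 / rho + 3 / 4 * N ^+ 2 * (v ^+ 2 / r) / rho ^+ 2.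
    have pd : p ^+ 2 <= 2 * d ^+ 2 + 2 * (N * v / (2 * r)) ^+ 2.
      have -> : p = d - N * v / (2 * r) by rewrite /d; ring.
      have := sqr_ge0 (d + N * v / (2 * r)); nra.
    have h : p ^+ 2 / r <= (2 * d ^+ 2 + 2 * (N * v / (2 * r)) ^+ 2) / r by rewrite ler_wpM2r.
    have h2 : d ^+ 2 * r^-1 <= d ^+ 2 * rho^-1 by rewrite ler_wpM2l// sqr_ge0.
    have h3 : N ^+ 2 * (v ^+ 2 / r) * r^-1 ^+ 2 <= N ^+ 2 * (v ^+ 2 / r) * rho^-1 ^+ 2.
      by rewrite ler_wpM2l// mulr_ge0// sqr_ge0.
    have E1 : (2 * d ^+ 2 + 2 * (N * v / (2 * r)) ^+ 2) / r =
      2 * (d ^+ 2 * r^-1) + 1 / 2 * (N ^+ 2 * (v ^+ 2 / r) * r^-1 ^+ 2).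
      by field; rewrite gt_eqF.
    have E2 : 3 * d ^+ 2 / rho + 3 / 4 * N ^+ 2 * (v ^+ 2 / r) / rho ^+ 2 =
      3 * (d ^+ 2 * rho^-1) + 3 / 4 * (N ^+ 2 * (v ^+ 2 / r) * rho^-1 ^+ 2).
      by rewrite -exprVn; ring.
    rewrite E2; rewrite E1 in h; lra.
  have h2 : K * v * p / r ^+ 2 <= 1 / 2 * (p ^+ 2 / r) + K ^+ 2 / 2 * (v ^+ 2 / r) / rho ^+ 2.
    have h3 : K ^+ 2 * (v ^+ 2 / r) * r^-1 ^+ 2 <= K ^+ 2 * (v ^+ 2 / r) * rho^-1 ^+ 2.
      by rewrite ler_wpM2l// mulr_ge0// sqr_ge0.
    have h4 : 0 <= (p - K * v / r) ^+ 2 / r by rewrite mulr_ge0// sqr_ge0.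
    have E1 : (p - K * v / r) ^+ 2 / r = p ^+ 2 / r - 2 * (K * v * p / r ^+ 2) +
      K ^+ 2 * (v ^+ 2 / r) * r^-1 ^+ 2 by field; rewrite gt_eqF.
    have E2 : K ^+ 2 / 2 * (v ^+ 2 / r) / rho ^+ 2 = 1 / 2 * (K ^+ 2 * (v ^+ 2 / r) * rho^-1 ^+ 2).
      by rewrite -exprVn; ring.
    rewrite E2; rewrite E1 in h4; lra.
  have h5 : 3 / rho * (4 * t * d ^+ 2) <= t * (4 * t * d ^+ 2).
    by rewrite ler_wpM2r// mulr_ge0 ?sqr_ge0// mulr_ge0// ltW.
  have h6 : 4 * t * (3 / 2 * (p ^+ 2 / r) + K * v * p / r ^+ 2) <=
     4 * t * (3 * d ^+ 2 / rho + 3 / 4 * N ^+ 2 * (v ^+ 2 / r) / rho ^+ 2 +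
     (1 / 2 * (p ^+ 2 / r) + K ^+ 2 / 2 * (v ^+ 2 / r) / rho ^+ 2)).
    by rewrite ler_wpM2l ?mulr_ge0 ?(ltW t0)// lerD.
  have -> : 4 * t * radial_error_const N / rho ^+ 2 * (v ^+ 2 / r) =
    4 * t * (3 / 4 * N ^+ 2 * (v ^+ 2 / r) / rho ^+ 2 + K ^+ 2 / 2 * (v ^+ 2 / r) / rho ^+ 2).
    by rewrite /radial_error_const -/K; ring.
  have E5 : t * (4 * t * d ^+ 2) = 4 * t ^+ 2 * d ^+ 2 by ring.
  have E6 : 3 / rho * (4 * t * d ^+ 2) = 4 * t * (3 * d ^+ 2 / rho) by ring.
  rewrite E5 E6 in h5; rewrite !mulrDr in h6 *; lra.
have -> : 4 * t * (t ^+ 2 + U) * (v ^+ 2 / r) =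
  4 * t ^+ 3 * (v ^+ 2 / r) + 4 * t * U * (v ^+ 2 / r) by ring.
have -> : (4 * t ^+ 3 - 4 * t ^+ 2 / rho - 4 * t * M - 2 * t * c2
    - 4 * t * radial_error_const N / rho ^+ 2) * (v ^+ 2 / r) =
  4 * t ^+ 3 * (v ^+ 2 / r) - 4 * t ^+ 2 / rho * (v ^+ 2 / r) - 4 * t * M * (v ^+ 2 / r)
  - 2 * t * c2 * (v ^+ 2 / r)
    - 4 * t * radial_error_const N / rho ^+ 2 * (v ^+ 2 / r) by ring.
have -> : 2 * t * (U * div3 + W * v ^+ 2) = 2 * t * U * div3 + 2 * t * (W * v ^+ 2) by ring.
lra.
Qed.

End pointwise_estimate.

(** * Expressions that integrate to zero *)

Section null_integral.
Context (R : realType) (n : nat).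
Local Notation V := 'rV[R]_n.
Local Notation mu := (lebesgueRn R n).
Implicit Types (f g h phi v U W : V -> R) (x y : V) (i : 'I_n) (rho M : R).

Definition null_integral h :=
  mu.-integrable setT (EFin \o h) /\ \int[mu]_x h x = 0.

Lemma null_integral_eq g h : null_integral g -> g =1 h -> null_integral h.
Proof. by move=> ng /funext <-. Qed.

Lemma null_integralD g h : null_integral g -> null_integral h ->
  null_integral (fun x => g x + h x).
Proof.
move=> [ig g0] [ih h0]; split; first exact: (integrableD measurableT ig ih).
by rewrite RintegralD// g0 h0 addr0.
Qed.

Lemma null_integralZ (c : R) h : null_integral h -> null_integral (fun x => c * h x).
Proof.
move=> [ih h0]; split; first exact: (integrableZl measurableT c ih).
by rewrite RintegralZl// h0 mulr0.
Qed.

Lemma null_integral_sum (h : 'I_n -> V -> R) : (forall i, null_integral (h i)) ->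
  null_integral (fun x => \sum_(i < n) h i x).
Proof.
move=> nh; elim: (index_enum _) => [|i r IH].
  under [X in null_integral X]eq_fun do rewrite big_nil.
  split; first exact: integrable0.
  by rewrite /Rintegral integral0.
under [X in null_integral X]eq_fun do rewrite big_cons.
exact: null_integralD.
Qed.

(** The inner boundary is a Euclidean sphere, as the weights are functions of the
    Euclidean norm; the outer one only provides compactness, and is measured in the
    sup norm, in which balls of R^n are cubes. *)
Definition off_shell rho M : set V := eball rho `|` [set x | M < `|x|].

Lemma open_off_shell rho M : open (off_shell rho M).
Proof.
apply: openU; first exact: open_eball.
rewrite (_ : [set x | _] = (fun x : V => `|x|) @^-1` [set r | M < r])//.
by apply: open_comp => [y _|]; [exact: norm_continuous|exact: open_gt].
Qed.

Definition shell_supported rho M f := forall x, off_shell rho M x -> f x = 0.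

Lemma shell_supported_pderiv rho M f i :
  shell_supported rho M f -> shell_supported rho M (pderiv i f).
Proof.
move=> f0 x xO; rewrite -(pderiv_cst i 0 x); apply: near_eq_pderiv.
exact: (open_near (@open_off_shell rho M)) xO.
Qed.

Lemma shell_supported_mul rho M f g :
  shell_supported rho M f -> shell_supported rho M (fun x => f x * g x).
Proof. by move=> f0 x /f0 ->; rewrite mul0r. Qed.

Lemma compact_shell rho M : compact (~` off_shell rho M).
Proof.
apply: bounded_closed_compact; last by apply: open_closedC; exact: open_off_shell.
exists M; split; first exact: num_real.
move=> z Mz x /= xO; rewrite leNgt; apply/negP => zx; apply: xO; right => /=.
exact: lt_trans zx.
Qed.

Lemma shell_punctured rho M : 0 < rho -> ~` off_shell rho M `<=` ~` [set (0 : V)].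
Proof.
move=> rho0 x xO /= x0; apply: xO; left; rewrite x0 /eball /= /enorm.
by rewrite big1 ?sqrtr0// => i _; rewrite mxE expr0n.
Qed.

Lemma null_integral_divergence rho M (F : 'I_n -> V -> R) : 0 < rho ->
  (forall i, smooth_on (@punctured R n) (F i)) ->
  (forall i, shell_supported rho M (F i)) -> null_integral (divergence F).
Proof.
move=> rho0 sF F0; apply: null_integral_sum => i.
have sFi : smooth (F i).
  by apply: (smooth_vanishing rho0) (sF i) _ => x xr; apply: F0; left.
have FiM x : M < `|x| -> F i x = 0 by move=> Mx; apply: F0; right.
have cF : continuous (pderiv i (F i)) by exact: (sFi [:: i]).1.
split; first exact: (integrable_compact_support cF (pderiv_eq0 i FiM)).
by rewrite /Rintegral (integral_pderiv ((sFi [::]).2 i) cF FiM).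
Qed.

Lemma integrable_shell_mul rho M U h : 0 < rho ->
  locally_integrable_on (~` [set 0]) U -> continuous h -> shell_supported rho M h ->
  mu.-integrable setT (EFin \o (fun x => U x * h x)).
Proof.
move=> rho0 [mU iU] ch h0; pose K : set V := ~` off_shell rho M.
have cK : compact K by exact: compact_shell.
have mK : measurable K.
  by apply: measurableC; apply: open_measurable_rV; exact: open_off_shell.
have -> : EFin \o (fun x => U x * h x) = (EFin \o (fun x => U x * h x)) \_ K.
  apply/funext => x; rewrite patchE; case: ifPn => //; rewrite notin_setE => xK.
  by rewrite /= h0 ?mulr0//; apply: contrapT.
apply/integrable_restrict => //; rewrite setTI.
have iUK := iU K cK (shell_punctured rho0).
have mh : measurable_fun K h by apply: measurable_funTS; exact: continuous_measurable_rV.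
have bh : [bounded h x | x in K].
  have /compact_bounded [N [Nr hN]] : compact (h @` K).
    by apply: continuous_compact => //; exact: continuous_subspaceT.
  by exists N; split => // y Ny x Kx; apply: (hN y Ny); exists x.
exact: (integrableMl mK iUK mh bh).
Qed.

(** The definition of the weak derivative, tested with [phi]; the support of [phi]
    makes both products integrable, so that the two integrals can be added. *)
Lemma null_integral_weak_derivative rho M U W phi : 0 < rho ->
  weak_radial_derivative U W -> smooth phi -> shell_supported rho M phi ->
  null_integral (fun x =>
    U x * divergence (fun i y => phi y * (y ord0 i / enorm y)) x + W x * phi x).
Proof.
move=> rho0 [lU lW UW] sphi phi0.
have sF i : smooth (fun y : V => phi y * (y ord0 i / enorm y)).
  apply: (smooth_vanishing rho0) => [|x xr]; last by rewrite phi0 ?mul0r//; left.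
  apply: smooth_on_mul; [exact: open_punctured|exact: smooth_on_smooth|].
  exact: smooth_on_radial_dir.
have cdiv : continuous (divergence (fun i (y : V) => phi y * (y ord0 i / enorm y))).
  move=> x; 
  apply: (regular_bigsum (h := fun i => pderiv i (fun y : V => phi y * (y ord0 i / enorm y)))
    _ (x := x) _).1 => i.
  by have /smooth_onT/smooth_on_pderiv/smooth_on_regular := sF i; apply.
have div0 : shell_supported rho M (divergence (fun i (y : V) => phi y * (y ord0 i / enorm y))).
  move=> x xO; apply: big1 => i _.
  by apply: shell_supported_pderiv xO; exact: shell_supported_mul.
have i1 := integrable_shell_mul rho0 lU cdiv div0.
have i2 := integrable_shell_mul rho0 lW (sphi [::]).1 phi0.
split; first exact: (integrableD measurableT i1 i2).
rewrite RintegralD// UW//; first by rewrite addNr.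
have cl : closure [set x | phi x != 0] `<=` ~` off_shell rho M.
  rewrite closureE; apply: smallest_sub; first by apply: open_closedC; exact: open_off_shell.
  by move=> x /= /eqP phix /phi0.
split.
  by apply: (subclosed_compact _ (@compact_shell rho M) cl); exact: closed_closure.
by apply: subset_trans cl _; exact: shell_punctured.
Qed.

End null_integral.

(** * The estimate for one real component *)

Section real_carleman.
Context (R : realType) (n : nat).
Local Notation V := 'rV[R]_n.
Local Notation mu := (lebesgueRn R n).
Local Notation N := (n%:R - 1 : R).
Implicit Types (f : V -> R) (x : V).

Definition carleman_rate (t rho M c : R) : R :=
  4 * t ^+ 3 - 4 * t ^+ 2 / rho - 4 * t * M - 2 * t * c
    - 4 * t * radial_error_const N / rho ^+ 2.

(** The function [H] carries everything that was integrated by parts. Outside the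
    ball of radius [rho] the inequality is [carleman_pointwise]; inside, [f] and [H]
    vanish. The test function for the weak derivative of [V2] is [v^2]. *)
Lemma real_carleman f (V2 W : V -> R) (t rho M c L : R) :
  0 < rho -> 3 / rho <= t -> smooth f -> shell_supported rho L f ->
  weak_radial_derivative V2 W ->
  exists2 H : V -> R, null_integral H &
    forall x, `|V2 x| <= M -> - c / enorm x <= W x ->
      carleman_rate t rho M c * (weighted t f x ^+ 2 / enorm x) + H x <=
      (expR (t * enorm x) * (laplacian f x + V2 x * f x)) ^+ 2.
Proof.
move=> rho0 trho sf f0 wV2; set v := weighted t f.
have sv : smooth v by apply: (smooth_weighted _ rho0 sf) => x xr; apply: f0; left.
have v0 : shell_supported rho L v by move=> x /f0 fx; rewrite /v /weighted fx mulr0.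
have dv0 i := shell_supported_pderiv i v0.
have oP := @open_punctured R n.
have svP := smooth_on_smooth (Omega := @punctured R n) sv.
have sdvP i := smooth_on_pderiv i svP.
have sdir := @smooth_on_radial_dir R n.
have srd : smooth_on (@punctured R n) (radial_derivative v).
  exact: (smooth_on_sum _ oP (fun i => smooth_on_mul oP (sdir i) (sdvP i))).
have sgq : smooth_on (@punctured R n) (grad_sq v).
  exact: (smooth_on_sum _ oP (fun i => smooth_on_mul oP (sdvP i) (sdvP i))).
(* The fields of [divergence_stress], [divergence_grad_over_r] and
   [divergence_scaled_radial]. *)
pose F1 i y := pderiv i v y * radial_derivative v y
     + (- (1 / 2)) * (radial_dir i y * grad_sq v y).
pose F2 i y := pderiv i v y * ((enorm y)^-1 * v y).
pose phi y := v y * v y.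
pose F3 i y := phi y * (y ord0 i / enorm y).
have n1 : null_integral (divergence F1).
  apply: (null_integral_divergence (M := L) rho0) => i.
    exact: (smooth_on_add oP (smooth_on_mul oP (sdvP i) srd)
      (smooth_on_mul oP (smooth_on_cst (- (1 / 2)) oP) (smooth_on_mul oP (sdir i) sgq))).
  move=> x xO; rewrite /F1 dv0// mul0r /grad_sq big1 ?mulr0 ?addr0// => j _.
  by rewrite dv0// expr0n.
have n2 : null_integral (divergence F2).
  apply: (null_integral_divergence (M := L) rho0) => i.
    exact: (smooth_on_mul oP (sdvP i) (smooth_on_mul oP (@smooth_on_enormV R n) svP)).
  by move=> x xO; rewrite /F2 dv0// mul0r.
have sphiP : smooth_on (@punctured R n) phi := smooth_on_mul oP svP svP.
have sphi : smooth phi.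
  apply: (smooth_vanishing rho0 sphiP) => x xr;
  by rewrite /phi (v0 _ (or_introl xr)) mul0r.
have phi0 : shell_supported rho L phi by move=> x xO; rewrite /phi v0 ?mul0r.
have n3 : null_integral (divergence F3).
  apply: (null_integral_divergence (M := L) rho0) => i.
    exact: (smooth_on_mul oP sphiP (sdir i)).
  by move=> x xO; rewrite /F3 phi0// mul0r.
have n4 := null_integral_weak_derivative rho0 wV2 sphi phi0.
exists (fun x => - 4 * t * (divergence F1 x + (N / 2 - 1) * divergence F2 x)
   - 2 * t ^+ 3 * divergence F3 x
   - 2 * t * (V2 x * divergence F3 x + W x * v x ^+ 2)).
  have := null_integralD (null_integralZ (- 4 * t)
      (null_integralD n1 (null_integralZ (N / 2 - 1) n2)))
    (null_integralD (null_integralZ (- (2 * t ^+ 3)) n3) (null_integralZ (- (2 * t)) n4)).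
  move/null_integral_eq; apply => x; rewrite -/F3 /phi; ring.
move=> x V2x Wx; have [xr|rx] := ltP (enorm x) rho.
  have xO : off_shell rho L x by left.
  have E1 (F : 'I_n -> V -> R) : (forall i, shell_supported rho L (F i)) -> divergence F x = 0.
    by move=> F0; apply: big1 => i _; exact: (shell_supported_pderiv i (F0 i)).
  have -> : divergence F1 x = 0.
    apply: E1 => i y yO; rewrite /F1 dv0// mul0r /grad_sq big1 ?mulr0 ?addr0// => j _.
    by rewrite dv0// expr0n.
  have -> : divergence F2 x = 0.
    by apply: E1 => i y yO; rewrite /F2 dv0// mul0r.
  have -> : divergence F3 x = 0.
    by apply: E1 => i y yO; rewrite /F3 phi0// mul0r.
  by rewrite v0// expr0n /= !(mul0r, mulr0, addr0, subr0) sqr_ge0.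
have x0 : 0 < enorm x by exact: lt_le_trans rho0 rx.
have rv : regular_at v x by move/smooth_onT : sv => /(_ [::] x I).
have rphi : regular_at phi x by exact: (regular_mul rv rv).
have E1 := divergence_stress sv x0.
have E2 := divergence_grad_over_r sv x0.
have E3 : divergence F3 x = 2 * (v x * radial_derivative v x) + v x ^+ 2 * (N / enorm x).
  by rewrite (divergence_scaled_radial rphi x0) (radial_derivative_sq rv).
have := carleman_pointwise rho0 rx trho V2x Wx E1 E2 E3.
rewrite -/F1 -/F2 -/F3 => /le_trans; apply.
rewrite le_eqVlt; apply/orP; left; apply/eqP; congr (_ ^+ 2).
by rewrite (laplacian_weighted sf sv x0) -/v /v /weighted; ring.
Qed.

End real_carleman.

(** * From real components to the complex inequality *)

Section assembly.
Context (R : realType) (n : nat).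
Local Notation V := 'rV[R]_n.
Local Notation mu := (lebesgueRn R n).
Local Notation N := (n%:R - 1 : R).
Implicit Types (x : V).

Lemma normc_sqr (z : R[i]) : normc z ^+ 2 = complex.Re z ^+ 2 + complex.Im z ^+ 2.
Proof. by case: z => a b /=; rewrite sqr_sqrtr// addr_ge0// sqr_ge0. Qed.

Lemma normc_nneg (z : R[i]) : 0 <= normc z.
Proof. by case: z => a b; exact: sqrtr_ge0. Qed.

Lemma ae_le_Linfty (g : V -> R[i]) : in_Linfty g ->
  {ae mu, forall x, normc (g x) <= fine (cLnorm +oo%E g)}.
Proof.
move=> [_ goo]; have g0 : (0 <= cLnorm +oo%E g)%E by exact: Lnorm_ge0.
have gE : (fine (cLnorm +oo%E g))%:E = cLnorm +oo%E g by rewrite fineK// ge0_fin_numE.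
have [mu0|mu0] := eqVneq (mu setT) 0%E.
  by exists setT; split => //; exact: measurableT.
have := ess_sup_ge mu (abse \o (fun x => (normc (g x))%:E)).
apply: filterS => x; rewrite -lee_fin gE /cLnorm unlock lt0e mu0 measure_ge0 /=.
by rewrite ger0_norm// normc_nneg.
Qed.

Lemma cLnorm2E (g : V -> R[i]) :
  (cLnorm 2%:E g = (\int[mu]_x ((normc (g x)) ^+ 2)%:E) `^ 2^-1)%E.
Proof.
rewrite /cLnorm unlock; congr (_ `^ _)%E; apply: eq_integral => x _.
by rewrite abse_EFin ger0_norm ?normc_nneg// poweR_EFin powR_mulrn// normc_nneg.
Qed.

(** The integral of [b] may be infinite, so [h] is compared with [b] through its
    positive part. *)
Lemma integral_le_of_ae (h b : V -> R) : mu.-integrable setT (EFin \o h) ->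
  measurable_fun setT b -> (forall x, 0 <= b x) ->
  {ae mu, forall x, h x <= b x} ->
  (\int[mu]_x (h x)%:E <= \int[mu]_x (b x)%:E)%E.
Proof.
move=> ih mb b0 hb; rewrite integralE.
apply: (@le_trans _ _ (\int[mu]_x ((EFin \o h)^\+ x))%E).
  rewrite leeBlDr ?leeDl ?integral_ge0//.
  exact: integrable_neg_fin_num.
have mh := measurable_int _ ih.
apply: ae_ge0_le_integral => //.
- exact: measurable_funepos.
- by move=> x _; rewrite lee_fin.
- exact/measurable_EFinP.
by apply: filterS hb => x hbx _; rewrite funeposE /= ge_max !lee_fin hbx b0.
Qed.

(** Chosen so that [carleman_rate_ge] holds: [3 / rho] is required by
    [carleman_pointwise], [2 / rho] dominates its quadratic error [4 t^2 / rho], and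
    the remaining summands dominate the linear errors and the contribution of the
    complex part of the potential. The bound on [V2] enters through
    [`|s| + `|c1|], [s] being the sup norm of the whole potential. *)
Definition threshold (rho s c1 c2 : R) : R :=
  1 + 5 / rho + 2 * (`|s| + `|c1|) + `|c2| + 2 * radial_error_const N / rho ^+ 2 + c1 ^+ 2.

Lemma radial_error_const_ge0 (m : R) : 0 <= radial_error_const m.
Proof. by rewrite /radial_error_const addr_ge0// mulr_ge0// sqr_ge0. Qed.

Lemma threshold_ge1 rho s c1 c2 : 0 < rho -> 1 <= threshold rho s c1 c2.
Proof.
move=> rho0; have h1 : 0 <= 5 / rho by rewrite divr_ge0// ltW.
have h2 : 0 <= 2 * radial_error_const N / rho ^+ 2.
  by rewrite divr_ge0 ?sqr_ge0// mulr_ge0// radial_error_const_ge0.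
rewrite /threshold; have := normr_ge0 s; have := normr_ge0 c1; have := normr_ge0 c2.
have := sqr_ge0 c1; lra.
Qed.

Lemma carleman_rate_ge (t rho s c1 c2 : R) : 0 < rho -> threshold rho s c1 c2 <= t ->
  3 / rho <= t /\
  2 * t ^+ 3 + 2 * c1 ^+ 2 <= carleman_rate n t rho (`|s| + `|c1|) `|c2|.
Proof.
move=> rho0; rewrite /threshold /carleman_rate.
set A := radial_error_const N / rho ^+ 2; set r := rho^-1; set M := `|s| + `|c1|; set c := `|c2|.
have -> : 2 * radial_error_const N / rho ^+ 2 = 2 * A by rewrite /A mulrA.
have -> : 4 * t * radial_error_const N / rho ^+ 2 = 4 * t * A by rewrite /A mulrA.
have A0 : 0 <= A by rewrite divr_ge0 ?sqr_ge0// radial_error_const_ge0.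
have r0 : 0 <= r by rewrite invr_ge0 ltW.
have M0 : 0 <= M by rewrite addr_ge0.
have c0 : 0 <= c by exact: normr_ge0.
have d0 : 0 <= c1 ^+ 2 by exact: sqr_ge0.
move=> ht; split; first lra.
have t1 : 1 <= t by lra.
have tt0 : 0 <= t ^+ 2 by exact: sqr_ge0.
have h1 : t * (2 * r + (2 * M + c + 2 * A + c1 ^+ 2)) <= t * t by rewrite ler_wpM2l; lra.
have h2 : t * (t * (2 * r + (2 * M + c + 2 * A + c1 ^+ 2))) <= t * (t * t).
  by rewrite ler_wpM2l//; lra.
have h3 : t * (2 * M + c + 2 * A + c1 ^+ 2) <= t * t * (2 * M + c + 2 * A + c1 ^+ 2).
  by rewrite ler_wpM2r//; [lra|rewrite ler_peMl; lra].
have h4 : c1 ^+ 2 <= t * c1 ^+ 2 by rewrite ler_peMl.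
have -> : t ^+ 3 = t * (t * t) by ring.
have -> : t ^+ 2 = t * t by ring.
nra.
Qed.

Lemma normc_sqr_image (E la lb : R) (z w : R[i]) :
  normc (E%:C * (Complex la lb + z * w)) ^+ 2 =
  (E * (la + (complex.Re z * complex.Re w - complex.Im z * complex.Im w))) ^+ 2
  + (E * (lb + (complex.Re z * complex.Im w + complex.Im z * complex.Re w))) ^+ 2.
Proof.
rewrite normc_sqr; case: z => p q; case: w => a b /=.
by congr (_ ^+ 2 + _ ^+ 2); ring.
Qed.

(** [|X + Y|^2 >= |X|^2 / 2 - |Y|^2]: the complex potential [z] is a perturbation
    of the operator with the real potential [u]. Losing the factor [1 / 2] is
    affordable since the real estimate has main term [4 tau^3]. *)
Lemma normc_sqr_perturb (E la lb u : R) (z w : R[i]) :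
  ((E * (la + u * complex.Re w)) ^+ 2 + (E * (lb + u * complex.Im w)) ^+ 2) / 2
    - normc z ^+ 2 * ((E * complex.Re w) ^+ 2 + (E * complex.Im w) ^+ 2) <=
  normc (E%:C * (Complex la lb + (z + u%:C) * w)) ^+ 2.
Proof.
rewrite normc_sqr_image normc_sqr -subr_ge0; case: z => p q; case: w => a b /=.
set X1 := E * (la + u * a); set X2 := E * (lb + u * b).
set Y1 := E * (p * a - q * b); set Y2 := E * (p * b + q * a).
rewrite [X in 0 <= X](_ : _ = (X1 + 2 * Y1) ^+ 2 / 2 + (X2 + 2 * Y2) ^+ 2 / 2); last first.
  by rewrite /X1 /X2 /Y1 /Y2; field.
by rewrite addr_ge0// divr_ge0// sqr_ge0.
Qed.

Lemma combine_components (K T3 a a1 a2 H1 H2 S1 S2 e c im : R) :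
  a = a1 + a2 -> K * a1 + H1 <= S1 -> K * a2 + H2 <= S2 ->
  (S1 + S2) / 2 - e <= im -> e <= c * a -> (2 * T3 + 2 * c) * a <= K * a ->
  T3 * a + 1 / 2 * (H1 + H2) <= im.
Proof. by move=> -> h1 h2 h3 h4 h5; lra. Qed.

Lemma support_in_shell (rho : R) (g : V -> R[i]) :
  compactly_supported_in (~` closure (eball rho)) g ->
  exists L, forall x, off_shell rho L x -> g x = 0.
Proof.
move=> [cg gsub].
have [L [_ gL]] := compact_bounded cg.
exists (`|L| + 1) => x xO; apply: contrapT => /eqP gx.
have xs : closure [set x | g x != 0] x by exact: subset_closure.
case: xO => [xr|/= xL]; first by apply: (gsub x xs); exact: subset_closure.
have LL : L < `|L| + 1 by rewrite (le_lt_trans (ler_norm L))// ltrDl.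
by have /= := gL _ LL x xs; rewrite leNgt xL.
Qed.

End assembly.

Section complex_carleman.
Context (R : realType) (n : nat).
Local Notation V := 'rV[R]_n.
Local Notation mu := (lebesgueRn R n).
Implicit Types (x : V).
Variables (rho c1 c2 tau : R) (Vp V1 : V -> R[i]) (V2 W : V -> R) (g : V -> R[i]).
Let s := fine (cLnorm +oo%E Vp).
Hypotheses (rho0 : 0 < rho) (VL : in_Linfty Vp)
  (VE : {ae mu, forall x, Vp x = V1 x + (V2 x)%:C})
  (V1b : {ae mu, forall x, normc (V1 x) <= c1 / japanese x `^ (1 / 2)})
  (wV2 : weak_radial_derivative V2 W)
  (Wb : {ae mu, forall x, - Num.min (W x) 0 <= c2 / enorm x})
  (ttau : threshold n rho s c1 c2 <= tau)
  (sg : csmooth g) (cg : compactly_supported_in (~` closure (eball rho)) g).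

Let fr x := complex.Re (g x).
Let fi x := complex.Im (g x).
Let weighted_density x : R :=
  (weighted tau fr x ^+ 2 + weighted tau fi x ^+ 2) / enorm x.
Let image_density x : R :=
  normc ((expR (tau * enorm x))%:C * (claplacian g x + Vp x * g x)) ^+ 2.

Lemma japanese_ge1 x : 1 <= japanese x.
Proof.
by rewrite -[leLHS]sqrtr1 /japanese ler_sqrt ?lerDl ?sqr_ge0// addr_ge0// sqr_ge0.
Qed.

Lemma enorm_le_japanese x : enorm x <= japanese x.
Proof.
rewrite -[leLHS]ger0_norm ?enorm_ge0// -sqrtr_sqr /japanese ler_sqrt ?lerDr//.
by rewrite addr_ge0// sqr_ge0.
Qed.

(** By the second bound, multiplication by the complex part of the potential costs
    at most [c1^2] times the weighted density. *)
Lemma normcV1_le x : normc (V1 x) <= c1 / japanese x `^ (1 / 2) ->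
  normc (V1 x) <= `|c1| /\
  (0 < enorm x -> normc (V1 x) ^+ 2 <= c1 ^+ 2 / enorm x).
Proof.
move=> V1x; have j1 := japanese_ge1 x; have j0 : 0 < japanese x by exact: lt_le_trans j1.
have jE : (japanese x `^ (1 / 2)) ^+ 2 = japanese x.
  by rewrite mul1r powR12_sqrt ?sqr_sqrtr// ltW.
have p0 : 0 < japanese x `^ (1 / 2) by exact: powR_gt0.
have p1 : 1 <= japanese x `^ (1 / 2).
  by rewrite -(@ler_pXn2r _ 2) ?nnegrE ?(ltW p0)// expr1n jE.
have V0 := normc_nneg (V1 x).
split.
  apply: (le_trans V1x); apply: (@le_trans _ _ (`|c1| / japanese x `^ (1 / 2))).
    by rewrite ler_wpM2r ?ler_norm// invr_ge0 ltW.
  by rewrite ler_pdivrMr// ler_peMr.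
move=> x0; apply: (@le_trans _ _ ((c1 / japanese x `^ (1 / 2)) ^+ 2)).
  by rewrite ler_pXn2r ?nnegrE// (le_trans V0 V1x).
rewrite expr_div_n jE ler_wpM2l ?sqr_ge0// lef_pV2//; exact: enorm_le_japanese.
Qed.

Lemma V2_bound : {ae mu, forall x, `|V2 x| <= `|s| + `|c1|}.
Proof.
have VLb := ae_le_Linfty VL.
near=> x.
have Vx : normc (Vp x) <= s by near: x; exact: VLb.
have VEx : Vp x = V1 x + (V2 x)%:C by near: x; exact: VE.
have [V1x _] : normc (V1 x) <= `|c1| /\
  (0 < enorm x -> normc (V1 x) ^+ 2 <= c1 ^+ 2 / enorm x).
  by apply: normcV1_le; near: x; exact: V1b.
have -> : `|V2 x| = normc (Vp x + - V1 x).
  by rewrite VEx addrAC subrr add0r /= expr0n addr0 sqrtr_sqr.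
rewrite (le_trans (le_normcD _ _))//.
rewrite normcN lerD//.
by rewrite (le_trans Vx)// ler_norm.
Unshelve. all: by end_near. Qed.

Lemma carleman_densities_le : exists2 H : V -> R, null_integral H &
  {ae mu, forall x, tau ^+ 3 * weighted_density x + H x <= image_density x}.
Proof.
have [sr si] := sg.
have [L gL] := support_in_shell cg.
have fr0 : shell_supported rho L fr by move=> x /gL; rewrite /fr => ->.
have fi0 : shell_supported rho L fi by move=> x /gL; rewrite /fi => ->.
have [rtau rate] := carleman_rate_ge rho0 ttau.
have [Hr nHr HrP] := real_carleman (`|s| + `|c1|) `|c2| rho0 rtau sr fr0 wV2.
have [Hi nHi HiP] := real_carleman (`|s| + `|c1|) `|c2| rho0 rtau si fi0 wV2.
exists (fun x => 1 / 2 * (Hr x + Hi x)).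
  by apply: null_integralZ; exact: null_integralD.
near=> x.
have V2x : `|V2 x| <= `|s| + `|c1| by near: x; exact: V2_bound.
have Wx : - `|c2| / enorm x <= W x.
  have Wx : - Num.min (W x) 0 <= c2 / enorm x by near: x; exact: Wb.
  have h : c2 / enorm x <= `|c2| / enorm x.
    by rewrite ler_wpM2r ?ler_norm// invr_ge0 enorm_ge0.
  have m : Num.min (W x) 0 <= W x by rewrite ge_min lexx.
  by rewrite mulNr; lra.
have VEx : Vp x = V1 x + (V2 x)%:C by near: x; exact: VE.
have V1x : normc (V1 x) <= `|c1| /\
  (0 < enorm x -> normc (V1 x) ^+ 2 <= c1 ^+ 2 / enorm x).
  by apply: normcV1_le; near: x; exact: V1b.
have {}HrP := HrP x V2x Wx; have {}HiP := HiP x V2x Wx.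
set E := expR (tau * enorm x) in HrP HiP *.
have pert := normc_sqr_perturb E (laplacian fr x) (laplacian fi x) (V2 x) (V1 x) (g x).
have wE : weighted_density x =
  weighted tau fr x ^+ 2 / enorm x + weighted tau fi x ^+ 2 / enorm x.
  by rewrite /weighted_density mulrDl.
set a := weighted_density x in wE *.
have a0 : 0 <= a by rewrite divr_ge0 ?enorm_ge0// addr_ge0// sqr_ge0.
have err : normc (V1 x) ^+ 2 * ((E * fr x) ^+ 2 + (E * fi x) ^+ 2) <= c1 ^+ 2 * a.
  have [xr|rx] := ltP (enorm x) rho.
    rewrite fr0 ?fi0; [|by left..].
    by rewrite mulr0 expr0n /= addr0 mulr0 mulr_ge0// sqr_ge0.
  have x0 : 0 < enorm x by exact: lt_le_trans rho0 rx.
  have -> : c1 ^+ 2 * a = c1 ^+ 2 / enorm x * ((E * fr x) ^+ 2 + (E * fi x) ^+ 2).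
    by rewrite /a /weighted_density /weighted -/E; ring.
  by rewrite ler_wpM2r; [by []|by rewrite addr_ge0// sqr_ge0|exact: V1x.2].
have rate_a : (2 * tau ^+ 3 + 2 * c1 ^+ 2) * a <=
    carleman_rate n tau rho (`|s| + `|c1|) `|c2| * a by rewrite ler_wpM2r.
rewrite /image_density VEx.
exact: (combine_components wE HrP HiP pert err rate_a).
Unshelve. all: by end_near. Qed.

Lemma integrable_weighted_density : mu.-integrable setT (EFin \o weighted_density).
Proof.
have [sr si] := sg.
have [L gL] := support_in_shell cg.
have oP := @open_punctured R n.
have sw (f : V -> R) : smooth f -> smooth_on (@punctured R n) (weighted tau f).
  move=> sf; apply: (smooth_on_mul oP (smooth_on_expR_enorm tau)).
  exact: smooth_on_smooth.
have swd : smooth_on (@punctured R n) weighted_density.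
  exact: (smooth_on_mul oP (smooth_on_add oP (smooth_on_mul oP (sw _ sr) (sw _ sr))
    (smooth_on_mul oP (sw _ si) (sw _ si))) (@smooth_on_enormV R n)).
have wd0 x : off_shell rho L x -> weighted_density x = 0.
  move=> /gL gx; rewrite /weighted_density /weighted /fr /fi gx /=.
  by rewrite mulr0 expr0n /= addr0 mul0r.
have sd : smooth weighted_density.
  by apply: (smooth_vanishing rho0 swd) => x xr; apply: wd0; left.
apply: (@integrable_compact_support _ _ _ L (sd [::]).1) => x xL.
by apply: wd0; right.
Qed.

Lemma measurable_image_density : measurable_fun setT image_density.
Proof.
have [sr si] := sg; have [[mVr mVi] _] := VL.
have mfr : measurable_fun setT fr by apply: continuous_measurable_rV; exact: (sr [::]).1.
have mfi : measurable_fun setT fi by apply: continuous_measurable_rV; exact: (si [::]).1.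
have mlap (f : V -> R) : smooth f -> measurable_fun setT (laplacian f).
  move=> sf; apply: measurable_sum => i; apply: continuous_measurable_rV.
  exact: (sf [:: i; i]).1.
have mE : measurable_fun setT (fun x : V => expR (tau * enorm x)).
  apply: continuous_measurable_rV => x.
  apply: (@continuous_comp _ _ _ (fun y : V => tau * enorm y)); last exact: continuous_expR.
  by apply: continuousM; [exact: cst_continuous|exact: continuous_enorm].
have -> : image_density = fun x =>
   (expR (tau * enorm x) * (laplacian fr x
     + (complex.Re (Vp x) * fr x - complex.Im (Vp x) * fi x))) ^+ 2
   + (expR (tau * enorm x) * (laplacian fi x
     + (complex.Re (Vp x) * fi x + complex.Im (Vp x) * fr x))) ^+ 2.
  by apply/funext => x; exact: normc_sqr_image.
apply: measurable_funD; apply: measurable_funX; apply: measurable_funM => //;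
  apply: measurable_funD; try exact: mlap.
  by apply: measurable_funB; apply: measurable_funM.
by apply: measurable_funD; apply: measurable_funM.
Qed.

Lemma integral_densities_le :
  ((tau ^+ 3)%:E * \int[mu]_x (weighted_density x)%:E <= \int[mu]_x (image_density x)%:E)%E.
Proof.
have [H [iH H0] HP] := carleman_densities_le.
have ia := integrable_weighted_density.
have i3 := integrableZl measurableT (tau ^+ 3) ia.
have ih : mu.-integrable setT (EFin \o (fun x => tau ^+ 3 * weighted_density x + H x)).
  exact: (integrableD measurableT i3 iH).
have := integral_le_of_ae ih measurable_image_density (fun x => sqr_ge0 _) HP.
apply: le_trans; rewrite -integralZl//.
have -> : (\int[mu]_x (tau ^+ 3 * weighted_density x + H x)%:E =
   \int[mu]_x ((tau ^+ 3)%:E * (weighted_density x)%:E) + \int[mu]_x (H x)%:E)%E.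
  by rewrite -integralD//; apply: eq_integral.
have -> : (\int[mu]_x (H x)%:E = 0)%E.
  have := integrable_fin_num measurableT iH.
  by rewrite -[RHS]/(0%:E) -H0 => /fineK <-.
by rewrite adde0.
Qed.

Lemma carleman_inequality :
      ((tau `^ (3 / 2))%:E *
         cLnorm 2%:E (fun x =>
           (enorm x `^ (- (1 / 2)) * expR (tau * enorm x))%:C * g x)%R
       <= cLnorm 2%:E (fun x =>
           (expR (tau * enorm x))%:C * (claplacian g x + Vp x * g x))%R)%E.
Proof.
have tau0 : 0 <= tau by apply: le_trans ttau; apply: le_trans (threshold_ge1 _ _ _ _ rho0).
have -> : tau `^ (3 / 2) = (tau ^+ 3) `^ 2^-1 by rewrite powRrM powR_mulrn.
rewrite !cLnorm2E -poweR_EFin -poweRM ?lee_fin ?exprn_ge0//; last first.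
  by apply: integral_ge0 => x _; rewrite lee_fin sqr_ge0.
have -> : (\int[mu]_x (normc ((enorm x `^ (- (1 / 2))
    * expR (tau * enorm x))%:C * g x) ^+ 2)%:E
    = \int[mu]_x (weighted_density x)%:E)%E.
  apply: eq_integral => x _; congr EFin; rewrite normc_sqr /weighted_density /weighted /fr /fi.
  have pE : (enorm x `^ (- (1 / 2))) ^+ 2 = (enorm x)^-1.
    by rewrite -powR_mulrn ?powR_ge0// -powRrM mulNr divfK// powR_inv1// enorm_ge0.
  rewrite -pE; case: (g x) => a b /=; ring.
apply: gt0_ler_poweR; rewrite ?in_itv/= ?leey ?andbT//.
- by rewrite mule_ge0 ?lee_fin ?exprn_ge0//; apply: integral_ge0 => x _;
    rewrite lee_fin divr_ge0 ?enorm_ge0// addr_ge0// sqr_ge0.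
- by apply: integral_ge0 => x _; rewrite lee_fin sqr_ge0.
- exact: integral_densities_le.
Qed.

End complex_carleman.

Theorem theorem6 (R : realType) (n : nat) :
  exists tau0 : R -> R -> R -> R -> R,
  forall (rho c1 c2 : R) (V V1 : 'rV[R]_n -> R[i]) (V2 : 'rV[R]_n -> R),
    0 < rho -> rho <= 1 ->
    in_Linfty V -> cmeasurable V1 -> measurable_fun setT V2 ->
    {ae lebesgueRn R n, forall x, V x = V1 x + (V2 x)%:C} ->
    {ae lebesgueRn R n, forall x, normc (V1 x) <= c1 / japanese x `^ (1 / 2)} ->
    {ae lebesgueRn R n, forall x, enorm x < 1 -> V2 x = 0} ->
    (exists2 W : 'rV[R]_n -> R, weak_radial_derivative V2 W &
      {ae lebesgueRn R n, forall x, - Num.min (W x) 0 <= c2 / enorm x}) ->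
    let t0 := tau0 rho (fine (cLnorm +oo%E V)) c1 c2 in
    0 < t0 /\
    forall (tau : R) (g : 'rV[R]_n -> R[i]),
      t0 <= tau ->
      csmooth g ->
      compactly_supported_in (~` closure (eball rho)) g ->
      ((tau `^ (3 / 2))%:E *
         cLnorm 2%:E (fun x =>
           (enorm x `^ (- (1 / 2)) * expR (tau * enorm x))%:C * g x)%R
       <= cLnorm 2%:E (fun x =>
           (expR (tau * enorm x))%:C * (claplacian g x + V x * g x))%R)%E.
Proof.
exists (threshold n) => rho c1 c2 V V1 V2 rho0 _ VL _ _ VE V1b _ [W wV2 Wb] t0; split.
  exact: lt_le_trans (threshold_ge1 _ _ _ _ rho0).
move=> tau g ttau sg cg.
exact: (carleman_inequality rho0 VL VE V1b wV2 Wb ttau sg cg).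
Qed.
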